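(* The canonical algebra homomorphism $\Phi:\mathcal{G}^d(\Omega)\to\mathcal{G}^e(\Omega)$ is not injective in general. Namely, for $s=1$ and $\Omega=\mathbb{R}$ there exists a function $R:U^d(\mathbb{R})\to\mathbb{C}$ such that (i) $R\in\mathcal{E}^d(\mathbb{R})$, (ii) $R\in\mathcal{E}^d_M(\mathbb{R})$, (iii) $R\notin\mathcal{N}^d(\mathbb{R})$, (iv) (the restriction to $U^e(\mathbb{R})$ of) $R$ belongs to $\mathcal{N}^e(\mathbb{R})$; hence $[R]\neq0$ in $\mathcal{G}^d(\mathbb{R})$, yet $\Phi[R]=0$ in $\mathcal{G}^e(\mathbb{R})$.
   Context: Notation: $\mathbb{N}=\{1,2,\dots\}$, $\mathbb{N}_0=\mathbb{N}\cup\{0\}$, $I=(0,1]$; $\Omega\subseteq\mathbb{R}^s$ open; $K\subset\subset\Omega$ means that $K$ is a compact subset of $\Omega$. $\mathcal{D}(\Omega)$ is the space of (complex-valued) compactly supported smooth functions on $\Omega$ with its usual (LF) topology. $\mathcal{A}_0(\Omega)=\{\varphi\in\mathcal{D}(\Omega):\int\varphi=1\}$; for $q\in\mathbb{N}$, $\mathcal{A}_q(\Omega)=\{\varphi\in\mathcal{A}_0(\Omega):\int\xi^\alpha\varphi(\xi)\,d\xi=0\text{ for }1\le|\alpha|\le q\}$. Calculus is that of convenient vector spaces (Kriegl–Michor): a map between (open subsets of closed affine subspaces of) locally convex spaces is smooth if it maps smooth curves to smooth curves. $S_\varepsilon\varphi(\xi)=\varepsilon^{-s}\varphi(\xi/\varepsilon)$,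 $T(\varphi,x)=(\varphi(\cdot-x),x)$. The algebra $\mathcal{G}^d(\Omega)$: $U^d(\Omega)=T^{-1}(\mathcal{A}_0(\Omega)\times\Omega)$; $\mathcal{E}^d(\Omega)=\mathcal{C}^\infty(U^d(\Omega))$ is the set of $R:U^d(\Omega)\to\mathbb{C}$ with $R\circ T^{-1}:\mathcal{A}_0(\Omega)\times\Omega\to\mathbb{C}$ smooth. $\mathcal{C}_b^\infty(I\times\Omega,\mathcal{A}_q(\mathbb{R}^s))$ is the set of all smooth maps $\phi:I\times\Omega\to\mathcal{A}_q(\mathbb{R}^s)$ such that for every $K\subset\subset\Omega$, $\alpha\in\mathbb{N}_0^s$ the set $\{\partial_x^\alpha\phi(\varepsilon,x):\varepsilon\in I,\ x\in K\}$ is bounded in $\mathcal{D}(\mathbb{R}^s)$. $R\in\mathcal{E}^d_M(\Omega)$ iff $R\in\mathcal{E}^d(\Omega)$ and $\forall K\subset\subset\Omega\ \forall\alpha\in\mathbb{N}_0^s\ \exists N\in\mathbb{N}\ \forall\phi\in\mathcal{C}_b^\infty(I\times\Omega,\mathcal{A}_0(\mathbb{R}^s))$: $\sup_{x\in K}|\partial^\alpha(R(S_\varepsilon\phi(\varepsilon,x),x))|=O(\varepsilon^{-N})$ as $\varepsilon\to0$. $R\in\mathcal{N}^d(\Omega)$ iff $\forall K\ \forall\alpha\ \forall n\in\mathbb{N}\ \exists q\in\mathbb{N}\ \forall\phi\in\mathcal{C}_b^\infty(I\times\Omega,\mathcal{A}_q(\mathbb{R}^s))$: $\sup_{x\in K}|\partial^\alpha(R(S_\varepsilon\phi(\varepsilon,x),x))|=O(\varepsilon^{n})$.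 $\mathcal{G}^d(\Omega)=\mathcal{E}^d_M(\Omega)/(\mathcal{N}^d(\Omega)\cap\mathcal{E}^d_M(\Omega))$. The algebra $\mathcal{G}^e(\Omega)$ (Colombeau's original full algebra): $U^e(\Omega)=T^{-1}(\mathcal{A}_1(\Omega)\times\Omega)$ (here $\mathcal A_1$ in the first factor is as in Colombeau's definition: for $(\varphi,x)\in U^e(\Omega)$ one has $\varphi\in\mathcal{A}_1(\mathbb{R}^s)$ and $x+\operatorname{supp}\varphi\subseteq\Omega$); $\mathcal{E}^e(\Omega)$ is the set of all $R:U^e(\Omega)\to\mathbb{C}$ such that for each $\varphi$ the map $x\mapsto R(\varphi,x)$ is smooth on the open set $\{x:(\varphi,x)\in U^e(\Omega)\}$. $R\in\mathcal{E}^e_M(\Omega)$ iff $\forall K\ \forall\alpha\ \exists N\ \forall\varphi\in\mathcal{A}_N(\mathbb{R}^s)$: $\sup_{x\in K}|\partial^\alpha(R(S_\varepsilon\varphi,x))|=O(\varepsilon^{-N})$. $R\in\mathcal{N}^e(\Omega)$ iff $\forall K\ \forall\alpha\ \forall n\ \exists q\ \forall\varphi\in\mathcal{A}_q(\mathbb{R}^s)$: $\sup_{x\in K}|\partial^\alpha(R(S_\varepsilon\varphi,x))|=O(\varepsilon^{n})$. $\mathcal{G}^e(\Omega)=\mathcal{E}^e_M(\Omega)/\mathcal{N}^e(\Omega)$. Restriction of functions from $U^d(\Omega)$ to $U^e(\Omega)$ maps $\mathcal{E}^d_M(\Omega)$ into $\mathcal{E}^e_M(\Omega)$ and $\mathcal{N}^d(\Omega)$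 into $\mathcal{N}^e(\Omega)$; $\Phi:\mathcal{G}^d(\Omega)\to\mathcal{G}^e(\Omega)$ is the induced algebra homomorphism. *)

(* Defs.v *)
(* Stdlib reals with Coquelicot.  The space dimension is s = 1, and [O] stands
   for an open subset of the real line. *)
From Stdlib Require Import Reals Lra Lia ClassicalEpsilon.
From Stdlib Require Import FunctionalExtensionality PropExtensionality ProofIrrelevance.
From Coquelicot Require Import Coquelicot.
Open Scope R_scope.

Definition whole : R -> Prop := fun _ => True.

Definition Dn (n : nat) (f : R -> C) (x : R) : C :=
  (Derive_n (fun t => Re (f t)) n x, Derive_n (fun t => Im (f t)) n x).

(* Meant for open [V]: [ex_derive_n] at x looks at values near x. *)
Definition smooth_on (V : R -> Prop) (f : R -> C) : Prop :=
  forall (n : nat) (x : R), V x ->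
    ex_derive_n (fun t => Re (f t)) n x /\ ex_derive_n (fun t => Im (f t)) n x.

Definition ccsub (K O : R -> Prop) : Prop := compact K /\ included K O.

Definition test_in (K : R -> Prop) (f : R -> C) : Prop :=
  smooth_on whole f /\ forall xi, ~ K xi -> f xi = RtoC 0.

Definition test (O : R -> Prop) (f : R -> C) : Prop :=
  exists K, ccsub K O /\ test_in K f.

Definition integral (f : R -> C) (v : C) : Prop :=
  is_RInt_gen (V := C_R_NormedModule) f
    (Rbar_locally m_infty) (Rbar_locally p_infty) v.

(* The set A_q(O), for q = 0 as well. *)
Definition A (q : nat) (O : R -> Prop) (f : R -> C) : Prop :=
  test O f /\ integral f (RtoC 1) /\
  forall k : nat, (1 <= k <= q)%nat ->
    integral (fun xi => (RtoC (xi ^ k) * f xi)%C) (RtoC 0).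

(* The (LF) topology is the finest locally convex topology that makes every
   inclusion D_K -> D(O) continuous, so a seminorm on D(O) is continuous iff
   its restriction to each D_K is, i.e. is dominated there by a C^m norm.
   The quantification over [B] replaces
   max_{j <= m} sup_xi |f^(j)(xi)|, the least such [B]. *)
Definition LF_seminorm (O : R -> Prop) (p : (R -> C) -> R) : Prop :=
  (forall f g, test O f -> test O g ->
     p (fun xi => (f xi + g xi)%C) <= p f + p g) /\
  (forall (z : C) f, test O f -> p (fun xi => (z * f xi)%C) = Cmod z * p f) /\
  (forall K, ccsub K O ->
     exists (m : nat) (c : R), forall f, test_in K f ->
       forall B, (forall (j : nat) xi, (j <= m)%nat -> Cmod (Dn j f xi) <= B) ->
         p f <= c * B).

Definition bounded_in_test (O : R -> Prop) (S : (R -> C) -> Prop) : Prop :=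
  (forall f, S f -> test O f) /\
  forall p, LF_seminorm O p -> exists M, forall f, S f -> p f <= M.

(* [c' t] is the derivative of the curve [c] in D(O) at every time [t]. *)
Definition curve_derivative (O : R -> Prop) (c c' : R -> (R -> C)) : Prop :=
  forall t p, LF_seminorm O p ->
    is_lim (fun h => p (fun xi =>
      (RtoC (/ h) * (c (t + h)%R xi - c t xi) - c' t xi)%C)) 0 0.

Definition smooth_curve (O : R -> Prop) (c : R -> (R -> C)) : Prop :=
  exists d : nat -> R -> (R -> C),
    (forall n t, test O (d n t)) /\
    (forall t, d 0%nat t = c t) /\
    (forall n, curve_derivative O (d n) (d (S n))).

Definition smooth_real_curve (V : R -> Prop) (x : R -> R) : Prop :=
  (forall t, V (x t)) /\ forall n t, ex_derive_n x n t.

Definition I01 (eps : R) : Prop := 0 < eps <= 1.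

Definition sup_bigO (K : R -> Prop) (g : R -> R -> C) (a : R -> R) : Prop :=
  exists M e0, 0 < e0 /\ forall eps x, I01 eps -> eps < e0 -> K x ->
    Cmod (g eps x) <= M * a eps.

Definition Sc (eps : R) (f : R -> C) : R -> C :=
  fun xi => (RtoC (/ eps) * f (xi / eps)%R)%C.

(* C_b^oo(I x O, A_q(R)).  Smoothness on I x O, where I = (0,1], means that
   smooth curves of the plane with values in I x O are mapped to smooth curves.
   Point evaluations are continuous and linear on D(R), so the derivatives of
   phi with respect to x may be computed for each xi separately. *)
Definition Cb (q : nat) (O : R -> Prop) (phi : R -> R -> (R -> C)) : Prop :=
  (forall eps x, I01 eps -> O x -> A q whole (phi eps x)) /\
  (forall e x, smooth_real_curve I01 e -> smooth_real_curve O x ->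
     smooth_curve whole (fun t => phi (e t) (x t))) /\
  (forall K (a : nat), ccsub K O ->
     bounded_in_test whole (fun f => exists eps x, I01 eps /\ K x /\
       f = fun xi => Dn a (fun y => phi eps y xi) x)).

Definition T (p : (R -> C) * R) : (R -> C) * R :=
  (fun xi => fst p (xi - snd p), snd p).

Definition Tinv (p : (R -> C) * R) : (R -> C) * R :=
  (fun xi => fst p (xi + snd p), snd p).

Definition inUd (O : R -> Prop) (p : (R -> C) * R) : Prop :=
  A 0 O (fst (T p)) /\ O (snd (T p)).

(* The vanishing first moment is required of the untranslated function;
   the condition on the translate says that x + supp phi is in O. *)
Definition inUe (O : R -> Prop) (p : (R -> C) * R) : Prop :=
  A 1 whole (fst p) /\ test O (fst (T p)) /\ O (snd (T p)).

Definition Ud (O : R -> Prop) : Type := {p : (R -> C) * R | inUd O p}.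
Definition Ue (O : R -> Prop) : Type := {p : (R -> C) * R | inUe O p}.

(* Extension by 0 of a function defined on the subset [P].  For x near a
   compact K and eps small, the points at which it is evaluated below lie in
   U^d, resp. U^e. *)
Definition extend {X : Type} {P : X -> Prop} (F : {x : X | P x} -> C) (x : X) : C :=
  match excluded_middle_informative (P x) with
  | left h => F (exist _ x h)
  | right _ => RtoC 0
  end.

Definition Ed (O : R -> Prop) (F : Ud O -> C) : Prop :=
  forall c x, smooth_curve O c -> (forall t, A 0 O (c t)) ->
    smooth_real_curve O x ->
    smooth_on whole (fun t => extend F (Tinv (c t, x t))).

Definition EMd (O : R -> Prop) (F : Ud O -> C) : Prop :=
  Ed O F /\
  forall K (a : nat), ccsub K O -> exists N : nat, (1 <= N)%nat /\
    forall phi, Cb 0 O phi ->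
      sup_bigO K
        (fun eps x => Dn a (fun y => extend F (Sc eps (phi eps y), y)) x)
        (fun eps => / eps ^ N).

Definition Nd (O : R -> Prop) (F : Ud O -> C) : Prop :=
  forall K (a n : nat), ccsub K O -> (1 <= n)%nat ->
    exists q : nat, (1 <= q)%nat /\
    forall phi, Cb q O phi ->
      sup_bigO K
        (fun eps x => Dn a (fun y => extend F (Sc eps (phi eps y), y)) x)
        (fun eps => eps ^ n).

Definition Ee (O : R -> Prop) (F : Ue O -> C) : Prop :=
  forall phi, smooth_on (fun x => inUe O (phi, x)) (fun x => extend F (phi, x)).

Definition EMe (O : R -> Prop) (F : Ue O -> C) : Prop :=
  Ee O F /\
  forall K (a : nat), ccsub K O -> exists N : nat, (1 <= N)%nat /\
    forall phi, A N whole phi ->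
      sup_bigO K
        (fun eps x => Dn a (fun y => extend F (Sc eps phi, y)) x)
        (fun eps => / eps ^ N).

Definition Ne (O : R -> Prop) (F : Ue O -> C) : Prop :=
  Ee O F /\
  forall K (a n : nat), ccsub K O -> (1 <= n)%nat ->
    exists q : nat, (1 <= q)%nat /\
    forall phi, A q whole phi ->
      sup_bigO K
        (fun eps x => Dn a (fun y => extend F (Sc eps phi, y)) x)
        (fun eps => eps ^ n).

Definition coset {U : Type} (J : (U -> C) -> Prop) (F : U -> C) : (U -> C) -> Prop :=
  fun G => J (fun u => (G u - F u)%C).

Definition Jd (O : R -> Prop) (F : Ud O -> C) : Prop := Nd O F /\ EMd O F.

Definition Gd (O : R -> Prop) : Type :=
  {X : (Ud O -> C) -> Prop | exists F, EMd O F /\ X = coset (Jd O) F}.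

Definition Ge (O : R -> Prop) : Type :=
  {X : (Ue O -> C) -> Prop | exists F, EMe O F /\ X = coset (Ne O) F}.

Definition class_d {O : R -> Prop} (F : Ud O -> C) (hF : EMd O F) : Gd O :=
  exist _ (coset (Jd O) F) (ex_intro _ F (conj hF eq_refl)).

Definition class_e {O : R -> Prop} (F : Ue O -> C) (hF : EMe O F) : Ge O :=
  exist _ (coset (Ne O) F) (ex_intro _ F (conj hF eq_refl)).

Lemma scal_C (k : R) (z : C) :
  scal (V := C_R_ModuleSpace) k z = (RtoC k * z)%C.
Proof.
destruct z as [a b].
change (scal k (a, b)) with (Rmult k a, Rmult k b).
unfold RtoC, Cmult; simpl; f_equal; ring.
Qed.

Lemma integral_comp_lin (f : R -> C) (u v : R) (l : C) :
  0 < u -> integral f l ->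
  integral (fun y => (RtoC u * f (u * y + v)%R)%C) l.
Proof.
intros hu H P hP.
destruct (H P hP) as [Q1 Q2 [M1 h1] [M2 h2] HQ].
exists (fun a => Q1 (u * a + v)) (fun b => Q2 (u * b + v)).
- exists ((M1 - v) / u); intros x hx; apply h1.
  apply Rmult_lt_compat_l with (r := u) in hx; auto.
  replace (u * ((M1 - v) / u)) with (M1 - v) in hx by (field; lra); lra.
- exists ((M2 - v) / u); intros x hx; apply h2.
  apply Rmult_lt_compat_l with (r := u) in hx; auto.
  replace (u * ((M2 - v) / u)) with (M2 - v) in hx by (field; lra); lra.
- intros a b ha hb. destruct (HQ _ _ ha hb) as [y [hy Py]].
  exists y; split; auto. simpl in *.
  eapply is_RInt_ext; [ | apply (is_RInt_comp_lin (V := C_R_NormedModule) f u v a b y hy)].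
  intros x _. apply (scal_C u).
Qed.

Lemma integral_ext (f g : R -> C) (l : C) :
  (forall x, f x = g x) -> integral f l -> integral g l.
Proof.
intros h; replace g with f; auto. apply functional_extensionality; auto.
Qed.

Lemma integral_scal (f : R -> C) (k : R) (l : C) :
  integral f l -> integral (fun x => (RtoC k * f x)%C) (RtoC k * l)%C.
Proof.
intros h.
pose proof (@is_RInt_gen_scal C_R_NormedModule (Rbar_locally m_infty)
  (Rbar_locally p_infty) _ _ f k l h) as H.
assert (e : (fun x => RtoC k * f x)%C =
            (fun x => @scal _ (NormedModule.ModuleSpace _ C_R_NormedModule) k (f x))).
{ apply functional_extensionality; intros x; symmetry; apply (scal_C k). }
rewrite e, <- (scal_C k l); exact H.
Qed.

Lemma Sc_lin (eps : R) (f : R -> C) (xi : R) :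
  Sc eps f xi = (RtoC (/ eps) * f (/ eps * xi + 0)%R)%C.
Proof. unfold Sc; do 2 f_equal; unfold Rdiv; ring. Qed.

Lemma test_Sc (eps : R) (f : R -> C) : 0 < eps -> test whole f -> test whole (Sc eps f).
Proof.
intros he [K [[cK _] [sf oK]]].
destruct (compact_P1 _ cK) as [m [M hM]].
exists (fun x => eps * m <= x <= eps * M); split; [split|split].
- apply compact_P3.
- intros x _; exact I.
- intros n x _.
  assert (s : forall g : R -> R, (forall n x, ex_derive_n g n x) ->
     ex_derive_n (fun y => / eps * g (/ eps * y)) n x).
  { intros g hg. apply ex_derive_n_scal_l.
    apply ex_derive_n_comp_scal. apply filter_forall; auto. }
  split.
  + apply ex_derive_n_ext with (fun y => / eps * Re (f (/ eps * y))).
    * intros t; unfold Sc, Rdiv; rewrite (Rmult_comm t (/ eps)); unfold Re, Im, Cmult, RtoC; cbn [fst snd]; ring.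
    * apply (s (fun y => Re (f y))); intros; apply sf; exact I.
  + apply ex_derive_n_ext with (fun y => / eps * Im (f (/ eps * y))).
    * intros t; unfold Sc, Rdiv; rewrite (Rmult_comm t (/ eps)); unfold Re, Im, Cmult, RtoC; cbn [fst snd]; ring.
    * apply (s (fun y => Im (f y))); intros; apply sf; exact I.
- intros x hx; unfold Sc; rewrite oK, Cmult_0_r; auto.
  intros hK; apply hM in hK; apply hx.
  assert (x = eps * (x / eps)) by (field; lra).
  split; rewrite H; apply Rmult_le_compat_l; lra.
Qed.

Lemma Cmult_swap (a b c d : C) : (a * (b * (c * d)) = a * c * (b * d))%C.
Proof. ring. Qed.

Lemma A_Sc (q : nat) (eps : R) (f : R -> C) :
  0 < eps -> A q whole f -> A q whole (Sc eps f).
Proof.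
intros he [tf [i0 ik]].
assert (hi : 0 < / eps) by (apply Rinv_0_lt_compat; auto).
split; [apply test_Sc; auto|split].
- eapply integral_ext; [|apply integral_comp_lin with (v := 0); [apply hi|apply i0]].
  intros x; symmetry; apply Sc_lin.
- intros k hk.
  eapply integral_ext with (f := fun x => (RtoC (eps ^ k) * (RtoC (/ eps) *
     (RtoC ((/ eps * x + 0) ^ k) * f (/ eps * x + 0)%R)))%C).
  { intros x; rewrite Sc_lin.
    replace (x ^ k) with (eps ^ k * (/ eps * x + 0) ^ k).
    - rewrite RtoC_mult; apply Cmult_swap.
    - rewrite <- Rpow_mult_distr; f_equal; field; lra. }
  replace (RtoC 0) with (RtoC (eps ^ k) * RtoC 0)%C by apply Cmult_0_r.
  apply integral_scal.
  apply (integral_comp_lin (fun x => (RtoC (x ^ k) * f x)%C)); auto.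
Qed.

Lemma A_le (q r : nat) O f : (q <= r)%nat -> A r O f -> A q O f.
Proof. intros h [t [i m]]; repeat split; auto; intros k hk; apply m; lia. Qed.

Lemma integral_translate (f : R -> C) (x : R) (l : C) :
  integral f l -> integral (fun xi => f (xi - x)) l.
Proof.
intros h; eapply integral_ext; [|apply (integral_comp_lin f 1 (- x)); [lra|apply h]].
intros y; simpl. rewrite Cmult_1_l; f_equal; ring.
Qed.

Lemma inUe_inUd O p : inUe O p -> inUd O p.
Proof.
intros [[tf [i _]] [tO Op]]; split; auto; split; [auto|split].
- apply integral_translate; auto.
- intros k hk; lia.
Qed.

Definition restrict {O : R -> Prop} (F : Ud O -> C) : Ue O -> C :=
  fun u => F (exist _ (proj1_sig u) (inUe_inUd O _ (proj2_sig u))).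

Lemma extend_in {X : Type} {P : X -> Prop} (F : {x : X | P x} -> C) x (h : P x) :
  extend F x = F (exist _ x h).
Proof.
unfold extend; destruct (excluded_middle_informative (P x)) as [h'|h'];
  [|contradiction].
do 2 f_equal; apply proof_irrelevance.
Qed.

Lemma extend_restrict O (F : Ud O -> C) p :
  inUe O p -> extend (restrict F) p = extend F p.
Proof.
intros h; rewrite (extend_in _ _ h), (extend_in _ _ (inUe_inUd _ _ h)); reflexivity.
Qed.

Lemma extend_plus {X} {P : X -> Prop} (F G : {x : X | P x} -> C) x :
  extend (fun u => (F u + G u)%C) x = (extend F x + extend G x)%C.
Proof.
unfold extend; destruct (excluded_middle_informative (P x)); auto; ring.
Qed.

Lemma extend_opp {X} {P : X -> Prop} (F : {x : X | P x} -> C) x :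
  extend (fun u => (- F u)%C) x = (- extend F x)%C.
Proof.
unfold extend; destruct (excluded_middle_informative (P x)); auto; ring.
Qed.

Lemma extend_0 {X} {P : X -> Prop} x :
  extend (fun _ : {x : X | P x} => RtoC 0) x = RtoC 0.
Proof. unfold extend; destruct (excluded_middle_informative (P x)); auto. Qed.

Lemma test_translate_whole f x : test whole f -> test whole (fun xi => f (xi - x)).
Proof.
intros [K [[cK _] [sf oK]]].
destruct (compact_P1 _ cK) as [m [M hM]].
exists (fun y => m + x <= y <= M + x); split; [split|split].
- apply compact_P3.
- intros y _; exact I.
- intros n y _; split;
  [ apply (ex_derive_n_comp_trans (fun t => Re (f t)) n y (- x))
  | apply (ex_derive_n_comp_trans (fun t => Im (f t)) n y (- x))]; apply sf; exact I.
- intros y hy; apply oK; intros hK; apply hM in hK; lra.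
Qed.

Lemma inUe_whole f x : A 1 whole f -> inUe whole (f, x).
Proof.
intros h; split; [exact h|split; [|exact I]].
apply test_translate_whole, h.
Qed.

Lemma smooth_plus f g :
  smooth_on whole f -> smooth_on whole g -> smooth_on whole (fun x => (f x + g x)%C).
Proof.
intros hf hg n x _; split;
  [ apply (ex_derive_n_plus (fun t => Re (f t)) (fun t => Re (g t)))
  | apply (ex_derive_n_plus (fun t => Im (f t)) (fun t => Im (g t)))];
  apply filter_forall; intros y k _; first [apply hf; exact I|apply hg; exact I].
Qed.

Lemma Dn_plus f g n x :
  smooth_on whole f -> smooth_on whole g ->
  Dn n (fun x => (f x + g x)%C) x = (Dn n f x + Dn n g x)%C.
Proof.
intros hf hg; unfold Dn, Cplus; cbn [fst snd]; f_equal;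
  [ apply (Derive_n_plus (fun t => Re (f t)) (fun t => Re (g t)))
  | apply (Derive_n_plus (fun t => Im (f t)) (fun t => Im (g t)))];
  apply filter_forall; intros y k _; first [apply hf; exact I|apply hg; exact I].
Qed.

Lemma smooth_opp f : smooth_on whole f -> smooth_on whole (fun x => (- f x)%C).
Proof.
intros hf n x _; split;
  [ apply (ex_derive_n_opp (fun t => Re (f t)))
  | apply (ex_derive_n_opp (fun t => Im (f t)))]; apply hf; exact I.
Qed.

Lemma Dn_opp f n x : Dn n (fun x => (- f x)%C) x = (- Dn n f x)%C.
Proof.
unfold Dn, Copp; cbn [fst snd]; f_equal;
  [ apply (Derive_n_opp (fun t => Re (f t)))
  | apply (Derive_n_opp (fun t => Im (f t)))].
Qed.

Lemma Derive_n_cst (a : R) n x : Derive_n (fun _ => a) n x = match n with O => a | _ => 0 end.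
Proof. destruct n; [reflexivity|apply Derive_n_const]. Qed.

Lemma smooth_cst V (z : C) : smooth_on V (fun _ => z).
Proof. intros n x _; split; apply ex_derive_n_const. Qed.

Lemma Dn_cst (z : C) n x : Dn n (fun _ => z) x = match n with O => z | _ => RtoC 0 end.
Proof.
unfold Dn; rewrite !Derive_n_cst; destruct n; auto. symmetry; apply surjective_pairing.
Qed.

Lemma Dn_0 f x : Dn 0 f x = f x.
Proof. unfold Dn; simpl. symmetry; apply surjective_pairing. Qed.

Lemma Dn_comp_trans f n x b : Dn n (fun y => f (y + b)) x = Dn n f (x + b).
Proof.
unfold Dn; f_equal;
  [ apply (Derive_n_comp_trans (fun t => Re (f t)))
  | apply (Derive_n_comp_trans (fun t => Im (f t)))].
Qed.

Lemma test_0 O : test O (fun _ => RtoC 0).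
Proof.
exists (fun _ => False); split; [split|split].
- apply (compact_eqDom (fun x => 1 <= x <= 0)).
  + apply compact_P3.
  + split; intros x hx; lra.
- intros x [].
- apply smooth_cst.
- auto.
Qed.

Lemma LF_seminorm_0 O p : LF_seminorm O p -> p (fun _ => RtoC 0) = 0.
Proof.
intros [_ [h _]]. specialize (h (RtoC 0) _ (test_0 O)).
rewrite Cmod_0, Rmult_0_l in h. transitivity (p (fun _ : R => (RtoC 0 * RtoC 0)%C)); [f_equal|exact h].
apply functional_extensionality; intros; symmetry; apply Cmult_0_l.
Qed.

Lemma Cdiff_0 (a b : C) : (a * (b - b) - RtoC 0)%C = RtoC 0.
Proof. ring. Qed.

Lemma curve_derivative_0 O c : curve_derivative O (fun _ => c) (fun _ _ => RtoC 0).
Proof.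
intros t p hp. apply is_lim_ext with (fun _ => 0); [|apply is_lim_const].
intros h; symmetry; transitivity (p (fun _ : R => RtoC 0));
  [f_equal|apply (LF_seminorm_0 O p hp)].
apply functional_extensionality; intros; apply Cdiff_0.
Qed.

Lemma Cb_const q O f : A q whole f -> Cb q O (fun _ _ => f).
Proof.
intros hf; split; [auto|split].
- intros e x _ _.
  exists (fun n _ => match n with O => f | _ => fun _ => RtoC 0 end).
  split; [|split; [reflexivity|]].
  + intros [|n] t; [apply hf|apply test_0].
  + intros [|n]; apply curve_derivative_0.
- intros K a _; split.
  + intros g [eps [x [_ [_ ->]]]].
    destruct a.
    * replace (fun xi => Dn 0 (fun _ => f xi) x) with f; [apply hf|].
      apply functional_extensionality; intros; rewrite Dn_cst; auto.
    * replace (fun xi => Dn (S a) (fun _ => f xi) x) with (fun _ : R => RtoC 0);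
      [apply test_0|].
      apply functional_extensionality; intros; rewrite Dn_cst; auto.
  + intros p hp. exists (p (match a with O => f | _ => fun _ => RtoC 0 end)).
    intros g [eps [x [_ [_ ->]]]]. right; f_equal.
    apply functional_extensionality; intros; rewrite Dn_cst; destruct a; auto.
Qed.

Lemma compact_support_bounded (g : R -> R) m M :
  (forall x, continuous g x) -> (forall x, ~ (m <= x <= M) -> g x = 0) ->
  exists B, forall x, Rabs (g x) <= B.
Proof.
intros cg og. destruct (Rle_dec m M) as [h|h].
- destruct (continuity_ab_maj (fun x => Rabs (g x)) m M h) as [x0 [hx0 _]].
  { intros c _. apply continuity_pt_filterlim.
    apply (continuous_comp g Rabs); [apply cg|apply continuous_Rabs]. }
  exists (Rabs (g x0)); intros x.
  destruct (excluded_middle_informative (m <= x <= M)) as [hx|hx]; auto.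
  rewrite (og x hx), Rabs_R0; apply Rabs_pos.
- exists 0; intros x; rewrite og, Rabs_R0; lra.
Qed.

Lemma Derive_n_support (g : R -> R) m M n x :
  (forall x, ~ (m <= x <= M) -> g x = 0) -> ~ (m <= x <= M) -> Derive_n g n x = 0.
Proof.
intros og hx.
rewrite (Derive_n_ext_loc g (fun _ => 0)).
- rewrite Derive_n_cst; destruct n; auto.
- assert (hx' : x < m \/ M < x) by lra. destruct hx' as [h|h].
  + assert (hd : 0 < m - x) by lra. exists (mkposreal _ hd); intros y hy; apply og.
    apply Rabs_lt_between' in hy; simpl in hy; lra.
  + assert (hd : 0 < x - M) by lra. exists (mkposreal _ hd); intros y hy; apply og.
    apply Rabs_lt_between' in hy; simpl in hy; lra.
Qed.

Lemma smooth_derivatives_bounded (g : R -> R) m M k :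
  (forall n x, ex_derive_n g n x) -> (forall x, ~ (m <= x <= M) -> g x = 0) ->
  exists B, forall n x, (n <= k)%nat -> Rabs (Derive_n g n x) <= B.
Proof.
intros sg og.
assert (one : forall n, exists B, forall x, Rabs (Derive_n g n x) <= B).
{ intros n; apply compact_support_bounded with m M.
  - intros x; apply (ex_derive_continuous (Derive_n g n)), (sg (S n)).
  - intros x; apply Derive_n_support; auto. }
induction k as [|k [B IH]].
- destruct (one 0%nat) as [B h]; exists B; intros [|n] x hn; [auto|lia].
- destruct (one (S k)) as [B' h]; exists (Rmax B B'); intros n x hn.
  destruct (Nat.eq_dec n (S k)) as [->|hne].
  + eapply Rle_trans; [apply h|apply Rmax_r].
  + eapply Rle_trans; [apply IH; lia|apply Rmax_l].
Qed.

Lemma diff_quotient_bound (g : R -> R) B y h :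
  (forall n x, ex_derive_n g n x) -> (forall x, Rabs (Derive_n g 2 x) <= B) ->
  h <> 0 -> Rabs (/ h * (g (y + h) - g y) - Derive g y) <= B * Rabs h.
Proof.
intros sg hB hh.
destruct (MVT_gen g y (y + h) (Derive g)) as [c [hc e1]].
{ intros x _; apply Derive_correct, (sg 1%nat). }
{ intros x _; apply continuity_pt_filterlim, (ex_derive_continuous g), (sg 1%nat). }
destruct (MVT_gen (Derive g) y c (Derive_n g 2)) as [d [hd e2]].
{ intros x _; apply Derive_correct, (sg 2%nat). }
{ intros x _; apply continuity_pt_filterlim, (ex_derive_continuous (Derive g)), (sg 2%nat). }
replace (/ h * (g (y + h) - g y) - Derive g y) with (Derive_n g 2 d * (c - y)).
- rewrite Rabs_mult; apply Rmult_le_compat; try apply Rabs_pos; [apply hB|].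
  revert hc; unfold Rmin, Rmax; destruct (Rle_dec y (y + h));
    unfold Rabs; destruct (Rcase_abs (c - y)), (Rcase_abs h); lra.
- rewrite <- e2, e1; field; auto.
Qed.

Lemma Cmod_le_parts z a b : Rabs (Re z) <= a -> Rabs (Im z) <= b -> Cmod z <= a + b.
Proof.
intros ha hb.
replace z with ((Re z, 0) + (0, Im z))%C.
- eapply Rle_trans; [apply Cmod_triangle|]. apply Rplus_le_compat.
  + unfold Cmod; simpl. replace (Re z * (Re z * 1) + 0 * (0 * 1)) with (Rsqr (Re z)) by (unfold Rsqr; ring).
    rewrite sqrt_Rsqr_abs; auto.
  + unfold Cmod; simpl. replace (0 * (0 * 1) + Im z * (Im z * 1)) with (Rsqr (Im z)) by (unfold Rsqr; ring).
    rewrite sqrt_Rsqr_abs; auto.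
- unfold Cplus, Re, Im; destruct z; simpl; f_equal; ring.
Qed.

Definition smoothR (g : R -> R) : Prop := forall n x, ex_derive_n g n x.

Lemma smooth_Re f : smooth_on whole f -> smoothR (fun x => Re (f x)).
Proof. intros h n x; apply h; exact I. Qed.

Lemma smooth_Im f : smooth_on whole f -> smoothR (fun x => Im (f x)).
Proof. intros h n x; apply h; exact I. Qed.

Lemma Derive_n_Derive g n x : Derive_n (Derive g) n x = Derive_n g (S n) x.
Proof. rewrite <- Nat.add_1_r; apply (Derive_n_comp g n 1 x). Qed.

Lemma smoothR_Derive g : smoothR g -> smoothR (Derive g).
Proof.
intros h [|n] x; [exact I|].
apply ex_derive_ext with (Derive_n g (S n)); [|apply (h (S (S n)))].
intros y; symmetry; apply Derive_n_Derive.
Qed.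

Definition quot (g : R -> R) (t h x : R) : R :=
  / h * (g (x + - (t + h)) - g (x + - t)) + Derive g (x + - t).

Lemma smoothR_trans g b : smoothR g -> smoothR (fun x => g (x + b)).
Proof. intros h n x; apply ex_derive_n_comp_trans, h. Qed.

Lemma smoothR_minus f g : smoothR f -> smoothR g -> smoothR (fun x => f x - g x).
Proof. intros hf hg n x; apply ex_derive_n_minus; apply filter_forall; auto. Qed.

Lemma smoothR_scal a g : smoothR g -> smoothR (fun x => a * g x).
Proof. intros hg n x; apply ex_derive_n_scal_l, hg. Qed.

Lemma quot_smooth g t h : smoothR g -> smoothR (quot g t h).
Proof.
intros hg n x. unfold quot.
apply (ex_derive_n_plus (fun x => / h * (g (x + - (t + h)) - g (x + - t)))
  (fun x => Derive g (x + - t))); apply filter_forall; intros y k _.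
- apply smoothR_scal, smoothR_minus; apply smoothR_trans, hg.
- apply smoothR_trans, smoothR_Derive, hg.
Qed.

Lemma quot_bound g B t h j x :
  smoothR g -> (forall x, Rabs (Derive_n g (S (S j)) x) <= B) -> h <> 0 ->
  Rabs (Derive_n (quot g t h) j x) <= B * Rabs h.
Proof.
intros hg hB hh. unfold quot.
rewrite (Derive_n_plus (fun x => / h * (g (x + - (t + h)) - g (x + - t)))
  (fun x => Derive g (x + - t))).
2, 3: apply filter_forall; intros y k _.
2: apply smoothR_scal, smoothR_minus; apply smoothR_trans, hg.
2: apply smoothR_trans, smoothR_Derive, hg.
rewrite (Derive_n_scal_l (fun x => g (x + - (t + h)) - g (x + - t))).
rewrite (Derive_n_minus (fun x => g (x + - (t + h))) (fun x => g (x + - t))).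
2, 3: apply filter_forall; intros y k _; apply smoothR_trans, hg.
rewrite !Derive_n_comp_trans, Derive_n_Derive.
assert (sj : smoothR (Derive_n g j)).
{ intros [|n] y; [exact I|].
  apply ex_derive_ext with (Derive_n g (n + j)); [|apply (hg (S (n + j)))].
  intros z; symmetry; apply Derive_n_comp. }
rewrite <- Rabs_Ropp, <- (Rabs_Ropp h).
replace (- (/ h * (Derive_n g j (x + - (t + h)) - Derive_n g j (x + - t)) +
    Derive_n g (S j) (x + - t)))
  with (/ (- h) * (Derive_n g j ((x + - t) + - h) - Derive_n g j (x + - t)) -
    Derive (Derive_n g j) (x + - t)).
- apply diff_quotient_bound; [exact sj|exact hB|lra].
- replace (x + - t + - h) with (x + - (t + h)) by ring.
  simpl; field; auto.
Qed.

Lemma test_whole_elim f : test whole f ->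
  smooth_on whole f /\ exists m M, forall x, ~ (m <= x <= M) -> f x = RtoC 0.
Proof.
intros [K [[cK _] [sf oK]]]; split; auto.
destruct (compact_P1 _ cK) as [m [M hM]]; exists m, M.
intros x hx; apply oK; intros hK; apply hx, hM, hK.
Qed.

Lemma LF_seminorm_ge0 O p f : LF_seminorm O p -> test O f -> 0 <= p f.
Proof.
intros hp tf. pose proof (LF_seminorm_0 O p hp) as h0.
destruct hp as [hD [hZ _]].
assert (tN : test O (fun xi => (RtoC (-1) * f xi)%C)).
{ destruct tf as [K [cK [sf oK]]]; exists K; split; auto; split.
  - intros n x _; split.
    + apply ex_derive_n_ext with (fun y => (-1) * Re (f y)).
      * intros y; unfold Re, Cmult, RtoC; cbn [fst snd]; ring.
      * apply (smoothR_scal (-1) (fun y => Re (f y))), smooth_Re, sf.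
    + apply ex_derive_n_ext with (fun y => (-1) * Im (f y)).
      * intros y; unfold Im, Cmult, RtoC; cbn [fst snd]; ring.
      * apply (smoothR_scal (-1) (fun y => Im (f y))), smooth_Im, sf.
  - intros x hx; rewrite oK; auto; apply Cmult_0_r. }
specialize (hD _ _ tf tN). rewrite (hZ (RtoC (-1)) f tf) in hD.
rewrite Cmod_R, Rabs_left in hD by lra.
replace (fun xi => (f xi + RtoC (-1) * f xi)%C) with (fun _ : R => RtoC 0) in hD; [lra|].
apply functional_extensionality; intros x.
unfold Cplus, Cmult, RtoC; destruct (f x); cbn [fst snd]; f_equal; ring.
Qed.

Lemma test_dN f : test whole f -> test whole (fun x => (- Dn 1 f x)%C).
Proof.
intros [K [hK [sf oK]]].
destruct (compact_P1 _ (proj1 hK)) as [m [M hM]].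
exists (fun x => m <= x <= M); split; [split; [apply compact_P3|intros x _; exact I]|split].
- apply smooth_opp; intros n x _; split;
  [ apply (smoothR_Derive (fun x => Re (f x))), smooth_Re, sf
  | apply (smoothR_Derive (fun x => Im (f x))), smooth_Im, sf].
- intros x hx. unfold Dn.
  rewrite (Derive_n_support (fun t => Re (f t)) m M),
    (Derive_n_support (fun t => Im (f t)) m M); auto.
  + unfold Copp, RtoC; simpl; f_equal; ring.
  + intros y hy; rewrite oK; auto.
  + intros y hy; rewrite oK; auto.
Qed.

Lemma translate_derivative f : test whole f ->
  curve_derivative whole (fun t xi => f (xi - t)) (fun t xi => (- Dn 1 f (xi - t))%C).
Proof.
intros tf t p hp.
destruct (test_whole_elim f tf) as [sf [m [M oM]]].
pose proof (proj2 (proj2 hp)) as hc.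
destruct (hc (fun x => m + t - 1 <= x <= M + t + 1)) as [k [c hk]].
{ split; [apply compact_P3|intros x _; exact I]. }
destruct (smooth_derivatives_bounded (fun x => Re (f x)) m M (S (S k))) as [B1 hB1].
{ apply smooth_Re, sf. }
{ intros x hx; rewrite oM; auto. }
destruct (smooth_derivatives_bounded (fun x => Im (f x)) m M (S (S k))) as [B2 hB2].
{ apply smooth_Im, sf. }
{ intros x hx; rewrite oM; auto. }
set (q := fun h xi => (RtoC (/ h) * (f (xi - (t + h))%R - f (xi - t)%R) -
  - Dn 1 f (xi - t)%R)%C).
assert (qR : forall h x, Re (q h x) = quot (fun y => Re (f y)) t h x).
{ intros h x; unfold q, quot, Dn, Cminus, Cplus, Copp, Cmult, RtoC, Re, Im, Rminus;
    cbn [fst snd Derive_n]; ring. }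
assert (qI : forall h x, Im (q h x) = quot (fun y => Im (f y)) t h x).
{ intros h x; unfold q, quot, Dn, Cminus, Cplus, Copp, Cmult, RtoC, Re, Im, Rminus;
    cbn [fst snd Derive_n]; ring. }
assert (tq : forall h, Rabs h < 1 -> test_in (fun x => m + t - 1 <= x <= M + t + 1) (q h)).
{ intros h hh; apply Rabs_def2 in hh; split.
  - intros n x _; split.
    + apply ex_derive_n_ext with (quot (fun y => Re (f y)) t h); [auto|].
      apply quot_smooth, smooth_Re, sf.
    + apply ex_derive_n_ext with (quot (fun y => Im (f y)) t h); [auto|].
      apply quot_smooth, smooth_Im, sf.
  - intros x hx; unfold q. rewrite (oM (x - (t + h))), (oM (x - t)) by lra.
    unfold Dn. rewrite (Derive_n_support (fun y => Re (f y)) m M 1),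
      (Derive_n_support (fun y => Im (f y)) m M 1);
      try lra; try (intros y hy; rewrite oM; auto).
    unfold Cminus, Cplus, Copp, Cmult, RtoC; cbn [fst snd]; f_equal; ring. }
assert (bq : forall h, Rabs h < 1 -> h <> 0 ->
  0 <= p (q h) <= c * (B1 + B2) * Rabs h).
{ intros h hh h0; split.
  - apply LF_seminorm_ge0 with whole; auto.
    exists (fun x => m + t - 1 <= x <= M + t + 1); split; [|apply tq; auto].
    split; [apply compact_P3|intros x _; exact I].
  - rewrite Rmult_assoc; apply hk; [apply tq; auto|].
    intros j x hj. rewrite Rmult_plus_distr_r. apply Cmod_le_parts; unfold Dn, Re, Im; cbn [fst snd].
    + rewrite (Derive_n_ext _ (quot (fun y => Re (f y)) t h)) by apply qR.
      apply quot_bound; auto; [apply smooth_Re, sf|intros; apply hB1; lia].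
    + rewrite (Derive_n_ext _ (quot (fun y => Im (f y)) t h)) by apply qI.
      apply quot_bound; auto; [apply smooth_Im, sf|intros; apply hB2; lia]. }
apply (is_lim_le_le_loc (fun _ => 0) (fun h => c * (B1 + B2) * Rabs h)).
- exists (mkposreal 1 Rlt_0_1); intros h hh h0.
  apply bq; auto.
  replace h with (h - 0) by ring; apply hh.
- apply is_lim_const.
- assert (hl : is_lim (fun h => c * (B1 + B2) * Rabs h) 0 (c * (B1 + B2) * Rabs 0)).
  { apply (is_lim_continuity (fun h => c * (B1 + B2) * Rabs h)).
    apply continuity_pt_mult; [apply continuity_pt_const; intros ? ?; auto|apply Rcontinuity_abs]. }
  rewrite Rabs_R0, Rmult_0_r in hl; exact hl.
Qed.

Lemma translate_smooth_curve f :
  test whole f -> smooth_curve whole (fun t xi => f (xi - t)).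
Proof.
intros tf.
set (g := fix g n := match n with O => f | S n => fun x => (- Dn 1 (g n) x)%C end).
assert (tg : forall n, test whole (g n)).
{ induction n; [exact tf|apply test_dN, IHn]. }
exists (fun n t xi => g n (xi - t)); split; [|split].
- intros n t; apply test_translate_whole, tg.
- reflexivity.
- intros n; apply (translate_derivative (g n)), tg.
Qed.

Lemma smooth_ext f g :
  (forall x, f x = g x) -> smooth_on whole f -> smooth_on whole g.
Proof. intros h; replace g with f; auto; apply functional_extensionality; auto. Qed.

Lemma Ed_section (F : Ud whole -> C) f :
  Ed whole F -> A 1 whole f -> smooth_on whole (fun x => extend F (f, x)).
Proof.
intros hF hf.
apply smooth_ext with (fun t => extend F (Tinv ((fun xi => f (xi - t)), t))).
{ intros t; f_equal; unfold Tinv; cbn [fst snd]; f_equal.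
  apply functional_extensionality; intros xi; f_equal; ring. }
apply (hF (fun t xi => f (xi - t)) (fun t => t)).
- apply translate_smooth_curve, hf.
- intros t; split; [apply test_translate_whole, hf|split].
  + apply integral_translate, (proj1 (proj2 hf)).
  + intros k hk; lia.
- split; [intros; exact I|].
  intros n t. destruct n as [|[|n]]; [exact I|apply ex_derive_id|].
  apply ex_derive_ext with (fun _ => match n with O => 1 | _ => 0 end).
  + intros y; rewrite <- (Derive_n_Derive (fun t => t)).
    rewrite (Derive_n_ext _ (fun _ => 1)) by (intros; apply Derive_id).
    rewrite Derive_n_cst; destruct n; auto.
  + apply ex_derive_const.
Qed.

Lemma restrict_Ee (F : Ud whole -> C) : Ed whole F -> Ee whole (restrict F).
Proof.
intros hF phi n x hx.
assert (hA : A 1 whole phi) by apply hx.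
revert n x hx.
assert (h : smooth_on whole (fun x => extend (restrict F) (phi, x))).
{ apply smooth_ext with (fun x => extend F (phi, x)); [|apply Ed_section; auto].
  intros x; symmetry; apply extend_restrict, inUe_whole, hA. }
intros n x _; apply h; exact I.
Qed.

Lemma restrict_Sc (F : Ud whole -> C) q eps f : (1 <= q)%nat -> 0 < eps -> A q whole f ->
  (fun y => extend (restrict F) (Sc eps f, y)) = (fun y => extend F (Sc eps f, y)).
Proof.
intros hq he hf; apply functional_extensionality; intros y.
apply extend_restrict, inUe_whole, A_Sc; auto. apply A_le with q; auto.
Qed.

Lemma restrict_EMe (F : Ud whole -> C) : EMd whole F -> EMe whole (restrict F).
Proof.
intros [hE hM]; split; [apply restrict_Ee, hE|].
intros K a hK; destruct (hM K a hK) as [N [hN h]].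
exists N; split; auto; intros f hf.
destruct (h (fun _ _ => f)) as [M [e0 [he0 hb]]].
{ apply Cb_const, (A_le 0 N); [lia|auto]. }
exists M, e0; split; auto; intros eps x he hlt hx.
rewrite (restrict_Sc F N); [apply hb; auto|auto|apply he|auto].
Qed.

Lemma restrict_Ne (F : Ud whole -> C) :
  Ed whole F -> Nd whole F -> Ne whole (restrict F).
Proof.
intros hE hN; split; [apply restrict_Ee, hE|].
intros K a n hK hn; destruct (hN K a n hK hn) as [q [hq h]].
exists q; split; auto; intros f hf.
destruct (h (fun _ _ => f)) as [M [e0 [he0 hb]]].
{ apply Cb_const; auto. }
exists M, e0; split; auto; intros eps x he hlt hx.
rewrite (restrict_Sc F q); [apply hb; auto|auto|apply he|auto].
Qed.

Lemma Ee_section (F : Ue whole -> C) f :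
  Ee whole F -> A 1 whole f -> smooth_on whole (fun x => extend F (f, x)).
Proof. intros h hf n x _; apply h, inUe_whole, hf. Qed.

Lemma Ne_plus (F G : Ue whole -> C) :
  Ne whole F -> Ne whole G -> Ne whole (fun u => (F u + G u)%C).
Proof.
intros [eF hF] [eG hG].
assert (s : forall f, A 1 whole f -> smooth_on whole
  (fun x => extend F (f, x) + extend G (f, x))%C).
{ intros f hf; apply smooth_plus; apply Ee_section; auto. }
assert (e : forall f, (fun x => extend (fun u => (F u + G u)%C) (f, x)) =
  (fun x => extend F (f, x) + extend G (f, x))%C).
{ intros f; apply functional_extensionality; intros x; apply extend_plus. }
split.
- intros f; rewrite e; intros n x hx; apply s; [apply hx|exact I].
- intros K a n hK hn.
  destruct (hF K a n hK hn) as [q1 [hq1 h1]], (hG K a n hK hn) as [q2 [hq2 h2]].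
  exists (max q1 q2); split; [lia|]; intros f hf.
  destruct (h1 f) as [M1 [e1 [he1 b1]]]; [apply A_le with (max q1 q2); auto; lia|].
  destruct (h2 f) as [M2 [e2 [he2 b2]]]; [apply A_le with (max q1 q2); auto; lia|].
  exists (M1 + M2), (Rmin e1 e2); split; [apply Rmin_pos; auto|].
  intros eps x he hlt hx.
  assert (eps < e1) by (eapply Rlt_le_trans; [apply hlt|apply Rmin_l]).
  assert (eps < e2) by (eapply Rlt_le_trans; [apply hlt|apply Rmin_r]).
  assert (hA : A 1 whole (Sc eps f)).
  { apply A_Sc; [apply he|apply A_le with (max q1 q2); auto; lia]. }
  rewrite e, Dn_plus by (apply Ee_section; auto).
  eapply Rle_trans; [apply Cmod_triangle|].
  rewrite Rmult_plus_distr_r; apply Rplus_le_compat; auto.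
Qed.

Lemma Ne_opp (F : Ue whole -> C) : Ne whole F -> Ne whole (fun u => (- F u)%C).
Proof.
intros [eF hF].
assert (e : forall f, (fun x => extend (fun u => (- F u)%C) (f, x)) =
  (fun x => - extend F (f, x))%C).
{ intros f; apply functional_extensionality; intros x; apply extend_opp. }
split.
- intros f; rewrite e; intros n x hx; apply smooth_opp; [|exact I].
  apply Ee_section; auto; apply hx.
- intros K a n hK hn; destruct (hF K a n hK hn) as [q [hq h]].
  exists q; split; auto; intros f hf; destruct (h f hf) as [M [e0 [he0 hb]]].
  exists M, e0; split; auto; intros eps x he hlt hx.
  rewrite e, Dn_opp, Cmod_opp; auto.
Qed.

Lemma sup_bigO_0 K a (w : R -> R) : (forall eps, 0 < eps -> 0 <= w eps) ->
  sup_bigO K (fun _ x => Dn a (fun _ => RtoC 0) x) w.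
Proof.
intros hw; exists 0, 1; split; [lra|]; intros eps x he _ _.
rewrite Dn_cst, Rmult_0_l; destruct a; rewrite Cmod_0; lra.
Qed.

Lemma EMd_0 O : EMd O (fun _ => RtoC 0).
Proof.
split.
- intros c x _ _ _.
  apply smooth_ext with (fun _ => RtoC 0); [|apply smooth_cst].
  intros t; symmetry; apply extend_0.
- intros K a hK; exists 1%nat; split; auto; intros phi _.
  destruct (sup_bigO_0 K a (fun eps => / eps ^ 1)) as [M [e0 [he0 h]]].
  { intros eps he; left; apply Rinv_0_lt_compat, pow_lt, he. }
  exists M, e0; split; auto; intros eps x he hlt hx.
  replace (fun y => extend (fun _ : Ud O => RtoC 0) (Sc eps (phi eps y), y)) with (fun _ : R => RtoC 0)
    by (apply functional_extensionality; intros; symmetry; apply extend_0).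
  apply h; auto.
Qed.

Lemma Nd_0 O : Nd O (fun _ => RtoC 0).
Proof.
intros K a n hK hn; exists 1%nat; split; auto; intros phi _.
destruct (sup_bigO_0 K a (fun eps => eps ^ n)) as [M [e0 [he0 h]]].
{ intros eps he; left; apply pow_lt, he. }
exists M, e0; split; auto; intros eps x he hlt hx.
replace (fun y => extend (fun _ : Ud O => RtoC 0) (Sc eps (phi eps y), y)) with (fun _ : R => RtoC 0)
    by (apply functional_extensionality; intros; symmetry; apply extend_0).
apply h; auto.
Qed.

Lemma EMe_0 O : EMe O (fun _ => RtoC 0).
Proof.
split.
- intros phi.
  replace (fun y => extend (fun _ : Ue O => RtoC 0) (phi, y)) with (fun _ : R => RtoC 0)
    by (apply functional_extensionality; intros; symmetry; apply extend_0).
  apply smooth_cst.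
- intros K a hK; exists 1%nat; split; auto; intros phi _.
  destruct (sup_bigO_0 K a (fun eps => / eps ^ 1)) as [M [e0 [he0 h]]].
  { intros eps he; left; apply Rinv_0_lt_compat, pow_lt, he. }
  exists M, e0; split; auto; intros eps x he hlt hx.
  replace (fun y => extend (fun _ : Ue O => RtoC 0) (Sc eps phi, y)) with (fun _ : R => RtoC 0)
    by (apply functional_extensionality; intros; symmetry; apply extend_0).
  apply h; auto.
Qed.

Definition zero_d (O : R -> Prop) : Gd O := class_d (fun _ => RtoC 0) (EMd_0 O).
Definition zero_e (O : R -> Prop) : Ge O := class_e (fun _ => RtoC 0) (EMe_0 O).

Lemma Phi_coset (F : Ud whole -> C) :
  (fun G => exists F', coset (Jd whole) F F' /\ coset (Ne whole) (restrict F') G) =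
  coset (Ne whole) (restrict F).
Proof.
apply functional_extensionality; intros G; apply propositional_extensionality; split.
- intros [F' [[h1 [h2 _]] h3]]. unfold coset in *.
  replace (fun u => (G u - restrict F u)%C) with
    (fun u => ((G u - restrict F' u) + restrict (fun u => F' u - F u) u)%C).
  + apply Ne_plus; auto. apply restrict_Ne; auto.
  + apply functional_extensionality; intros u; unfold restrict.
    generalize (G u); intros z; generalize dependent F'; intros; ring.
- intros h; exists F; split; auto.
  unfold coset. replace (fun u => (F u - F u)%C) with (fun _ : Ud whole => RtoC 0).
  + split; [apply Nd_0|apply EMd_0].
  + apply functional_extensionality; intros u; symmetry; apply Cplus_opp_r.
Qed.

Lemma Phi_subproof (X : Gd whole) :
  exists F, EMe whole F /\
    (fun G => exists F', proj1_sig X F' /\ coset (Ne whole) (restrict F') G) =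
    coset (Ne whole) F.
Proof.
destruct X as [X [F [hF ->]]]; exists (restrict F); split.
- apply restrict_EMe, hF.
- apply Phi_coset.
Qed.

(* The map induced by restriction: Phi (F + J) = F|U^e + N^e, see [Phi_class]. *)
Definition Phi (X : Gd whole) : Ge whole :=
  exist _ (fun G => exists F, proj1_sig X F /\ coset (Ne whole) (restrict F) G)
    (Phi_subproof X).

Lemma Phi_class (F : Ud whole -> C) (hF : EMd whole F) :
  Phi (class_d F hF) = class_e (restrict F) (restrict_EMe F hF).
Proof.
apply eq_sig_hprop; [intros; apply proof_irrelevance|]. apply Phi_coset.
Qed.

(* Main.v *)
Require Import Defs.
From Stdlib Require Import Reals Lra Lia Factorial FunctionalExtensionality ProofIrrelevance.
From Coquelicot Require Import Coquelicot.

(** The idea is to let a functional of phi read off its size in units of 1 / eps.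
Evaluation at the origin, L phi = Re (phi 0), satisfies
L (Sc eps phi) = L phi / eps.  Let chi be a smooth function supported in [0, 2]
with chi 1 > 0, and let R (phi, x) = chi (L phi) ([witness]).

For a fixed phi the value chi (L phi / eps) vanishes once eps is small: the
argument is 0 if L phi = 0 and leaves the support of chi otherwise.  As R does
not depend on x, all x-derivatives vanish as well, so R is negligible for the
tests of G^e ([witness_Ne]).  The tests of G^d may depend on eps, and this
lets L phi be of the order of eps: for every q there is a bounded path
phi_eps = f + eps g in A_q with L phi_eps = eps ([affine_path]), along which
R (Sc eps phi_eps, x) = chi 1 for all eps ([witness_not_Nd]).  Such a path only
needs an element of A_q that does not vanish at 0; it is obtained from a bump
by affine combinations of phi and Sc 2 phi, which cancel one moment after the
other ([A_nonzero_at_0]).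

R is moderate ([witness_EMd]) because an x-derivative of order a of
chi (L (phi eps x) / eps) is a polynomial in derivatives of chi, which are
bounded, and in derivatives of L (phi eps x) / eps, which are O(1 / eps), of
degree at most a in the latter.  This count is made by a grading instead of the
formula of Faa di Bruno.  Finally R belongs to E^d ([witness_Ed]) because in the
coordinates of T it is chi of (phi, x) |-> Re (phi x), and this evaluation is
smooth along smooth curves: all the suprema sup |f^(j)| are continuous
seminorms of D(R), which controls the values of the difference quotients of the
curve at the moving point ([evaluation_derive]). *)

(** * Graded algebras of families closed under differentiation *)

(** The degree is an upper bound for the exponent of 1 / eps in the growth of a
family of functions indexed by eps; hence a family may be given a larger degree
than necessary.  Constant families make the same algebra a tool for smoothness
proofs: what is closed under differentiation is smooth. *)
Inductive graded (B : nat -> (R -> R -> R) -> Prop) : nat -> (R -> R -> R) -> Prop :=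
| graded_base n f : B n f -> graded B n f
| graded_weaken n f : graded B n f -> graded B (S n) f
| graded_plus n f g : graded B n f -> graded B n g ->
    graded B n (fun e y => f e y + g e y)
| graded_mult n m f g : graded B n f -> graded B m g ->
    graded B (n + m) (fun e y => f e y * g e y).

(** Differentiation in the second variable maps B into G and raises the degree
by at most one, as the chain rule brings out one inner derivative. *)
Definition derivations_in (E : R -> Prop) (B G : nat -> (R -> R -> R) -> Prop) : Prop :=
  forall n f, B n f -> exists f', G (S n) f' /\
    forall e y, E e -> is_derive (f e) y (f' e y).

Lemma graded_derive E B :
  derivations_in E B (graded B) -> derivations_in E (graded B) (graded B).
Proof.
intros hB n f hf; induction hf as [n f h|n f _ [f' [h d]]|n f g _ [f' [hf' df]] _ [g' [hg' dg]]
  |n m f g hf [f' [hf' df]] hg [g' [hg' dg]]].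
- apply hB, h.
- exists f'; split; auto; apply graded_weaken, h.
- exists (fun e y => f' e y + g' e y); split; [apply graded_plus; auto|].
  intros e y he; apply (is_derive_plus (f e) (g e)); auto.
- exists (fun e y => f' e y * g e y + f e y * g' e y); split.
  + apply (graded_plus B (S (n + m)) (fun e y => f' e y * g e y) (fun e y => f e y * g' e y)).
    * apply (graded_mult B (S n) m); auto.
    * rewrite plus_n_Sm; apply graded_mult; auto.
  + intros e y he; apply (is_derive_mult (f e) (g e)); auto.
    intros a b; apply Rmult_comm.
Qed.

Lemma graded_Derive_n E B k n f :
  derivations_in E B (graded B) -> graded B n f ->
  exists g, graded B (k + n) g /\ forall e, E e -> forall y, Derive_n (f e) k y = g e y.
Proof.
intros hB hf; induction k as [|k [g [hg eg]]].
- exists f; split; auto.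
- destruct (graded_derive E B hB _ _ hg) as [g' [hg' dg]].
  exists g'; split; auto; intros e he y; simpl.
  rewrite (Derive_ext _ (g e)) by (intros; apply eg, he).
  apply is_derive_unique, dg, he.
Qed.

Lemma graded_smooth E B n f e :
  derivations_in E B (graded B) -> graded B n f -> E e -> smoothR (f e).
Proof.
intros hB hf he [|k] y; [exact I|]; simpl.
destruct (graded_Derive_n E B k n f hB hf) as [g [hg eg]].
destruct (graded_derive E B hB _ _ hg) as [g' [_ dg]].
apply ex_derive_ext with (g e); [intros t; symmetry; apply eg, he|].
exists (g' e y); apply dg, he.
Qed.

(** Weakening the degree is harmless because 1 <= 1 / e for e in (0, 1]. *)
Lemma graded_bound B K n f :
  (forall n f, B n f -> exists c, forall e y, I01 e -> K y -> Rabs (f e y) <= c * / e ^ n) ->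
  graded B n f -> exists c, forall e y, I01 e -> K y -> Rabs (f e y) <= c * / e ^ n.
Proof.
intros hB hf; induction hf as [n f h|n f _ [c h]|n f g _ [c hc] _ [d hd]
  |n m f g _ [c hc] _ [d hd]].
- apply hB, h.
- exists c; intros e y he hy; eapply Rle_trans; [apply h; auto|].
  assert (0 <= c * / e ^ n) by (eapply Rle_trans; [apply Rabs_pos|apply h; eauto]).
  destruct he as [h0 h1]; simpl; rewrite Rinv_mult.
  assert (1 <= / e) by (rewrite <- Rinv_1; apply Rinv_le_contravar; lra).
  nra.
- exists (c + d); intros e y he hy.
  eapply Rle_trans; [apply Rabs_triang|].
  specialize (hc e y he hy); specialize (hd e y he hy); lra.
- exists (c * d); intros e y he hy; rewrite Rabs_mult, pow_add, Rinv_mult.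
  replace (c * d * (/ e ^ n * / e ^ m)) with ((c * / e ^ n) * (d * / e ^ m)) by ring.
  apply Rmult_le_compat; try apply Rabs_pos; auto.
Qed.

Lemma smoothR_is_derive g n x : smoothR g -> is_derive (Derive_n g n) x (Derive_n g (S n) x).
Proof. intros h; apply Derive_correct, (h (S n)). Qed.

(** The factors that occur in the derivatives of chi (u e y).  Only those of the
inner function cost a power of 1 / eps. *)
Inductive comp_base (chi : R -> R) (u : R -> R -> R) : nat -> (R -> R -> R) -> Prop :=
| comp_base_outer k : comp_base chi u 0 (fun e y => Derive_n chi k (u e y))
| comp_base_inner k : comp_base chi u 1 (fun e y => Derive_n (u e) (S k) y).

Lemma comp_base_derive E chi u :
  smoothR chi -> (forall e, E e -> smoothR (u e)) ->
  derivations_in E (comp_base chi u) (graded (comp_base chi u)).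
Proof.
intros hchi hu n f [k|k].
- exists (fun e y => Derive_n (u e) 1 y * Derive_n chi (S k) (u e y)); split.
  + apply (graded_mult _ 1 0 (fun e y => Derive_n (u e) 1 y)
      (fun e y => Derive_n chi (S k) (u e y))); apply graded_base; constructor.
  + intros e y he.
    apply (is_derive_comp (Derive_n chi k) (u e)); [apply smoothR_is_derive, hchi|].
    apply (smoothR_is_derive (u e) 0), hu, he.
- exists (fun e y => Derive_n (u e) (S (S k)) y); split.
  + apply graded_weaken, graded_base; constructor.
  + intros e y he; apply smoothR_is_derive, hu, he.
Qed.

Lemma smoothR_comp chi u : smoothR chi -> smoothR u -> smoothR (fun y => chi (u y)).
Proof.
intros hchi hu.
apply (graded_smooth whole (comp_base chi (fun _ => u)) 0 (fun _ y => chi (u y)) 0).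
- apply comp_base_derive; auto.
- apply graded_base, (comp_base_outer chi (fun _ => u) 0).
- exact I.
Qed.

(** * A bump function *)

(** The functions x^(-k) exp (-1/x), extended by 0, span a space closed under
differentiation, so all of them are smooth. *)
Definition flat (k : nat) (x : R) : R :=
  if Rlt_dec 0 x then (/ x) ^ k * exp (- / x) else 0.

Lemma pow_exp_bound n y : 0 <= y -> y ^ n <= INR (fact n) * exp y.
Proof.
intros hy. pose proof (INR_fact_lt_0 n) as hn.
assert (h : y ^ n / INR (fact n) <= exp y).
{ apply Rle_trans with (sum_f_R0 (fun k => y ^ k / INR (fact k)) n); [|apply exp_ge_taylor, hy].
  destruct n as [|n]; [simpl; lra|]. rewrite tech5.
  enough (0 <= sum_f_R0 (fun k => y ^ k / INR (fact k)) n) by lra.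
  apply cond_pos_sum; intros k; apply Rdiv_le_0_compat; [apply pow_le, hy|apply INR_fact_lt_0]. }
apply Rmult_le_compat_r with (r := INR (fact n)) in h; [|lra].
replace (y ^ n / INR (fact n) * INR (fact n)) with (y ^ n) in h by (field; lra). lra.
Qed.

(** As flat k x / x = flat (k + 1) x, this bound also says that the
derivative of flat k at 0 is 0. *)
Lemma flat_bound k x : Rabs (flat (S k) x) <= INR (fact (S (S k))) * Rabs x.
Proof.
unfold flat; destruct (Rlt_dec 0 x) as [h|h].
- assert (hi : 0 < / x) by (apply Rinv_0_lt_compat; auto).
  pose proof (pow_exp_bound (S (S k)) (/ x) (Rlt_le _ _ hi)) as hb.
  pose proof (exp_pos (/ x)) as he.
  rewrite !Rabs_right; [|lra|].
  + rewrite exp_Ropp. apply Rmult_le_reg_r with (/ x * exp (/ x)); [nra|].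
    replace ((/ x) ^ S k * / exp (/ x) * (/ x * exp (/ x))) with ((/ x) ^ S (S k)) by (simpl; field; lra).
    replace (INR (fact (S (S k))) * x * (/ x * exp (/ x)))
      with (INR (fact (S (S k))) * exp (/ x)) by (field; lra).
    exact hb.
  + apply Rle_ge, Rmult_le_pos; [apply pow_le; lra|left; apply exp_pos].
- rewrite Rabs_R0; apply Rmult_le_pos; [left; apply INR_fact_lt_0|apply Rabs_pos].
Qed.

Lemma flat_derive k x :
  is_derive (flat k) x (flat (S (S k)) x - INR k * flat (S k) x).
Proof.
destruct (Rtotal_order x 0) as [h|[->|h]].
- replace (flat (S (S k)) x - INR k * flat (S k) x) with 0
    by (unfold flat; destruct (Rlt_dec 0 x); lra).
  assert (hd : 0 < - x) by lra.
  apply is_derive_ext_loc with (fun _ => 0); [|apply (is_derive_const (V := R_NormedModule) 0)].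
  exists (mkposreal _ hd); intros y hy; apply Rabs_lt_between' in hy; simpl in hy.
  unfold flat; destruct (Rlt_dec 0 y); lra.
- replace (flat (S (S k)) 0 - INR k * flat (S k) 0) with 0
    by (unfold flat; destruct (Rlt_dec 0 0); lra).
  apply is_derive_Reals; intros eps heps.
  pose proof (INR_fact_lt_0 (S (S k))) as hf.
  assert (hd : 0 < eps / INR (fact (S (S k)))) by (apply Rdiv_lt_0_compat; auto).
  exists (mkposreal _ hd); intros h h0 hh; cbn [pos] in hh.
  replace ((flat k (0 + h) - flat k 0) / h - 0) with (flat (S k) h).
  + eapply Rle_lt_trans; [apply flat_bound|].
    apply Rmult_lt_compat_l with (r := INR (fact (S (S k)))) in hh; auto.
    replace (INR (fact (S (S k))) * (eps / INR (fact (S (S k))))) with eps in hh by (field; lra).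
    exact hh.
  + rewrite Rplus_0_l; unfold flat.
    destruct (Rlt_dec 0 0), (Rlt_dec 0 h); try lra.
    cbn [pow]; generalize ((/ h) ^ k) (exp (- / h)); intros z w.
    change (/ h * z * w = (z * w - 0) / h - 0); field; auto.
- apply Rgt_lt in h.
  apply is_derive_ext_loc with (fun x => (/ x) ^ k * exp (- / x)).
  { exists (mkposreal x h); intros y hy; apply Rabs_lt_between' in hy; simpl in hy.
    unfold flat; destruct (Rlt_dec 0 y); lra. }
  unfold flat; destruct (Rlt_dec 0 x); [|lra].
  auto_derive; [lra|]. generalize (exp (- / x)); intros z.
  destruct k as [|k]; [simpl; field; lra|].
  cbn [pred pow]; generalize ((/ x) ^ k) (INR (S k)); intros; field; lra.
Qed.

Lemma flat_smooth : smoothR (flat 0).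
Proof.
set (B := fun (_ : nat) f => (exists k : nat, f = (fun _ : R => flat k)) \/
  exists c, f = (fun _ _ : R => c)).
apply (graded_smooth whole B 0 (fun _ => flat 0) 0).
- intros n f [[k ->]|[c ->]].
  + exists (fun _ y => flat (S (S k)) y + - INR k * flat (S k) y); split.
    * apply (graded_plus B (S n) (fun _ => flat (S (S k))) (fun _ y => - INR k * flat (S k) y)).
      -- apply graded_base; left; eauto.
      -- apply (graded_mult B 0 (S n) (fun _ _ => - INR k) (fun _ => flat (S k)));
           apply graded_base; [right|left]; eauto.
    * intros _ y _. replace (flat (S (S k)) y + - INR k * flat (S k) y)
        with (flat (S (S k)) y - INR k * flat (S k) y) by ring. apply flat_derive.
  + exists (fun _ _ => 0); split; [apply graded_base; right; eauto|].
    intros _ y _; apply (is_derive_const (V := R_NormedModule) c).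
- apply graded_base; left; eauto.
- exact I.
Qed.

Definition bump (x : R) : R := flat 0 (1 - x ^ 2).

Lemma bump_smooth : smoothR bump.
Proof.
apply (smoothR_comp (flat 0) (fun x => 1 - x ^ 2)); [apply flat_smooth|].
apply smoothR_minus; intros n x; [apply ex_derive_n_const|apply ex_derive_n_pow].
Qed.

Lemma bump_pos x : -1 < x < 1 -> 0 < bump x.
Proof.
intros h; unfold bump, flat; destruct (Rlt_dec 0 (1 - x ^ 2)); [|nra].
rewrite pow_O, Rmult_1_l; apply exp_pos.
Qed.

Lemma bump_out x : ~ (-1 < x < 1) -> bump x = 0.
Proof.
intros h; unfold bump, flat; destruct (Rlt_dec 0 (1 - x ^ 2)); auto.
exfalso; apply h; nra.
Qed.

(** * The supremum of a derivative as a continuous seminorm *)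

Lemma smooth_scal z f : smooth_on whole f -> smooth_on whole (fun x => (z * f x)%C).
Proof.
intros hf n x _; split.
- apply (ex_derive_n_minus (fun x => Re z * Re (f x)) (fun x => Im z * Im (f x)));
    apply filter_forall; intros y k _; apply smoothR_scal; [apply smooth_Re|apply smooth_Im]; auto.
- apply (ex_derive_n_plus (fun x => Re z * Im (f x)) (fun x => Im z * Re (f x)));
    apply filter_forall; intros y k _; apply smoothR_scal; [apply smooth_Im|apply smooth_Re]; auto.
Qed.

Lemma Dn_scal z f n x : smooth_on whole f ->
  Dn n (fun x => (z * f x)%C) x = (z * Dn n f x)%C.
Proof.
intros hf; unfold Dn, Cmult at 3; cbn [fst snd].
rewrite <- !Derive_n_scal_l; f_equal.
- rewrite <- Derive_n_minus; [reflexivity| |]; apply filter_forall; intros y k _;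
    apply smoothR_scal; [apply smooth_Re|apply smooth_Im]; auto.
- rewrite <- Derive_n_plus; [reflexivity| |]; apply filter_forall; intros y k _;
    apply smoothR_scal; [apply smooth_Im|apply smooth_Re]; auto.
Qed.

Lemma smooth_RtoC g : smoothR g -> smooth_on whole (fun x => RtoC (g x)).
Proof. intros hg n x _; split; [exact (hg n x)|exact (ex_derive_n_const 0 n x)]. Qed.

Lemma test_whole_intro f m M : smooth_on whole f ->
  (forall x, ~ (m <= x <= M) -> f x = RtoC 0) -> test whole f.
Proof.
intros sf of; exists (fun x => m <= x <= M); split; [split|split]; auto.
- apply compact_P3.
- intros x _; exact I.
Qed.

Lemma test_plus f g : test whole f -> test whole g -> test whole (fun x => (f x + g x)%C).
Proof.
intros tf tg.
destruct (test_whole_elim f tf) as [sf [m [M of]]], (test_whole_elim g tg) as [sg [m' [M' og]]].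
apply test_whole_intro with (Rmin m m') (Rmax M M'); [apply smooth_plus; auto|].
intros x hx; rewrite of, og.
- apply Cplus_0_l.
- intros [h1 h2]; apply hx; split; [eapply Rle_trans; [apply Rmin_r|auto]|
    eapply Rle_trans; [apply h2|apply Rmax_r]].
- intros [h1 h2]; apply hx; split; [eapply Rle_trans; [apply Rmin_l|auto]|
    eapply Rle_trans; [apply h2|apply Rmax_l]].
Qed.

Lemma test_scal z f : test whole f -> test whole (fun x => (z * f x)%C).
Proof.
intros tf; destruct (test_whole_elim f tf) as [sf [m [M of]]].
apply test_whole_intro with m M; [apply smooth_scal, sf|].
intros x hx; rewrite of by auto; apply Cmult_0_r.
Qed.

Lemma test_in_whole K f : ccsub K whole -> test_in K f -> test whole f.
Proof. intros hK hf; exists K; auto. Qed.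

Definition sup_norm (j : nat) (f : R -> C) : R :=
  real (Lub_Rbar (fun r => exists x, r = Cmod (Dn j f x))).

(** The supremum is finite because the derivatives of a test function are
bounded. *)
Lemma sup_norm_spec j f : test whole f ->
  (forall x, Cmod (Dn j f x) <= sup_norm j f) /\
  (forall B, (forall x, Cmod (Dn j f x) <= B) -> sup_norm j f <= B).
Proof.
intros tf; destruct (test_whole_elim f tf) as [sf [m [M of]]].
destruct (smooth_derivatives_bounded (fun x => Re (f x)) m M j) as [b hb];
  [apply smooth_Re, sf|intros x hx; rewrite of; auto|].
destruct (smooth_derivatives_bounded (fun x => Im (f x)) m M j) as [c hc];
  [apply smooth_Im, sf|intros x hx; rewrite of; auto|].
assert (h : forall x, Cmod (Dn j f x) <= b + c).
{ intros x; apply Cmod_le_parts; [apply hb|apply hc]; auto. }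
unfold sup_norm.
destruct (Lub_Rbar_correct (fun r => exists x, r = Cmod (Dn j f x))) as [up least].
destruct (Lub_Rbar _) as [l| |].
- split.
  + intros x; apply (up (Cmod (Dn j f x))); eauto.
  + intros B hB; apply (least (Finite B)); intros r [x ->]; apply hB.
- exfalso; apply (least (Finite (b + c))); intros r [x ->]; apply h.
- exfalso; apply (up (Cmod (Dn j f 0))); eauto.
Qed.

Lemma sup_norm_LF j : LF_seminorm whole (sup_norm j).
Proof.
split; [|split].
- intros f g tf tg; apply sup_norm_spec; [apply test_plus; auto|].
  intros x; rewrite Dn_plus by (apply test_whole_elim; auto).
  eapply Rle_trans; [apply Cmod_triangle|].
  apply Rplus_le_compat; apply sup_norm_spec; auto.
- intros z f tf; pose proof (test_scal z f tf) as tzf.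
  assert (e : forall x, Cmod (Dn j (fun x => (z * f x)%C) x) = Cmod z * Cmod (Dn j f x)).
  { intros x; rewrite Dn_scal by (apply test_whole_elim, tf); apply Cmod_mult. }
  apply Rle_antisym.
  + apply sup_norm_spec; auto; intros x; rewrite e.
    apply Rmult_le_compat_l; [apply Cmod_ge_0|apply sup_norm_spec, tf].
  + destruct (sup_norm_spec j _ tzf) as [h _].
    destruct (Cmod_ge_0 z) as [hz|hz].
    * apply Rmult_le_reg_l with (/ Cmod z); [apply Rinv_0_lt_compat, hz|].
      rewrite <- Rmult_assoc, Rinv_l, Rmult_1_l by lra.
      apply sup_norm_spec; auto; intros x.
      apply Rmult_le_reg_l with (Cmod z); auto.
      rewrite <- Rmult_assoc, Rinv_r, Rmult_1_l, <- e by lra; apply h.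
    * rewrite <- hz, Rmult_0_l; eapply Rle_trans; [apply Cmod_ge_0|apply (h 0)].
- intros K hK; exists j, 1; intros f hf B hB; rewrite Rmult_1_l.
  apply sup_norm_spec; [apply test_in_whole with K; auto|]; auto.
Qed.

(** * Evaluation of a smooth curve of test functions at a moving point *)

Lemma test_diff_quotient a b c d : test whole a -> test whole b -> test whole c ->
  test whole (fun x => (RtoC d * (a x - b x) - c x)%C).
Proof.
intros ha hb hc.
replace (fun x => (RtoC d * (a x - b x) - c x)%C) with
  (fun x => (RtoC d * (a x + RtoC (-1) * b x) + RtoC (-1) * c x)%C).
- apply (test_plus (fun x => (RtoC d * (a x + RtoC (-1) * b x))%C));
    [apply test_scal, (test_plus a), test_scal|apply test_scal]; auto.
- apply functional_extensionality; intros x.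
  replace (RtoC (-1)) with (- RtoC 1)%C by (symmetry; apply (RtoC_opp 1)); ring.
Qed.

Lemma Dn_diff_quotient a b c d j x : test whole a -> test whole b -> test whole c ->
  Re (Dn j (fun x => (RtoC d * (a x - b x) - c x)%C) x) =
  d * (Re (Dn j a x) - Re (Dn j b x)) - Re (Dn j c x).
Proof.
intros ha hb hc.
assert (s : forall f, test whole f -> smoothR (fun x => Re (f x))).
{ intros f tf; apply smooth_Re, test_whole_elim, tf. }
unfold Dn, Re at 1 3 5 7; cbn [fst].
rewrite (Derive_n_ext _ (fun x => d * (Re (a x) - Re (b x)) - Re (c x))).
2: { intros t; unfold Cminus, Cplus, Copp, Cmult, RtoC, Re; cbn [fst snd]; ring. }
rewrite (Derive_n_minus (fun x => d * (Re (a x) - Re (b x))) (fun x => Re (c x))).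
2, 3: apply filter_forall; intros y k _.
2: apply smoothR_scal, smoothR_minus; apply s; auto.
2: apply s, hc.
rewrite (Derive_n_scal_l (fun x => Re (a x) - Re (b x))).
rewrite (Derive_n_minus (fun x => Re (a x)) (fun x => Re (b x))); [reflexivity| |];
  apply filter_forall; intros y k _; apply s; auto.
Qed.

(** With k = Re (c t)^(j) and k' = Re (c' t)^(j), the difference quotient minus
its limit splits into three terms: the error of the difference quotient of the
curve c, taken at x (t + h) and bounded by its sup norm; the increment of k'
along x; and the error of the difference quotient of k along x. *)
Lemma evaluation_derive c c' x j t :
  (forall t, test whole (c t)) -> (forall t, test whole (c' t)) ->
  curve_derivative whole c c' -> smoothR x ->
  is_derive (fun t => Re (Dn j (c t) (x t))) t
    (Re (Dn j (c' t) (x t)) + Derive x t * Re (Dn (S j) (c t) (x t))).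
Proof.
intros tc tc' hc hx.
set (k := Derive_n (fun y => Re (c t y)) j).
set (k' := Derive_n (fun y => Re (c' t y)) j).
assert (sc : forall f, test whole f -> smoothR (fun y => Re (f y))).
{ intros f tf; apply smooth_Re, test_whole_elim, tf. }
assert (h1 := proj2 (is_lim_spec _ _ _) (hc t _ (sup_norm_LF j))).
assert (h2 : continuous (fun s => k' (x s)) t).
{ apply (continuous_comp x k').
  - apply (ex_derive_continuous x), (hx 1%nat).
  - apply (ex_derive_continuous k'), (sc _ (tc' t) (S j)). }
assert (h3 : is_derive (fun s => k (x s)) t (Derive x t * Derive_n (fun y => Re (c t y)) (S j) (x t))).
{ apply (is_derive_comp k x); [apply smoothR_is_derive, sc, tc|].
  apply (smoothR_is_derive x 0), hx. }
apply is_derive_Reals in h3; apply is_derive_Reals; intros eps heps.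
assert (he : 0 < eps / 3) by lra.
destruct (h1 (mkposreal _ he)) as [d1 H1].
apply continuity_pt_filterlim in h2.
destruct (h2 _ he) as [d2 [hd2 H2]].
destruct (h3 _ he) as [d3 H3].
assert (hd : 0 < Rmin d1 (Rmin d2 d3)).
{ apply Rmin_pos; [apply d1|apply Rmin_pos; [auto|apply d3]]. }
exists (mkposreal _ hd); intros h h0 hh; cbn [pos] in hh.
assert (hh1 : Rabs h < d1) by (eapply Rlt_le_trans; [apply hh|apply Rmin_l]).
assert (hh2 : Rabs h < d2).
{ eapply Rlt_le_trans; [apply hh|]; eapply Rle_trans; [apply Rmin_r|apply Rmin_l]. }
assert (hh3 : Rabs h < d3).
{ eapply Rlt_le_trans; [apply hh|]; eapply Rle_trans; [apply Rmin_r|apply Rmin_r]. }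
specialize (H3 h h0 hh3).
assert (H1' := H1 h). cbn beta in H1'. rewrite Rminus_0_r in H1'.
assert (B1 : Rabs (/ h * (Re (Dn j (c (t + h)) (x (t + h))) - k (x (t + h))) - k' (x (t + h))) < eps / 3).
{ unfold k, k'.
  change (Rabs (/ h * (Re (Dn j (c (t + h)) (x (t + h))) - Re (Dn j (c t) (x (t + h)))) -
    Re (Dn j (c' t) (x (t + h)))) < eps / 3).
  rewrite <- Dn_diff_quotient by auto.
  eapply Rle_lt_trans; [apply re_le_Cmod|].
  eapply Rle_lt_trans; [|eapply Rle_lt_trans; [apply Rle_abs|apply H1']]; auto.
  - apply sup_norm_spec, test_diff_quotient; auto.
  - change (Rabs (h - 0) < d1); rewrite Rminus_0_r; auto. }
assert (B2 : Rabs (k' (x (t + h)) - k' (x t)) < eps / 3).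
{ apply (H2 (t + h)); split; [split; [exact I|lra]|].
  simpl; unfold Rdist; replace (t + h - t) with h by ring; auto. }
change (Rabs ((Re (Dn j (c (t + h)) (x (t + h))) - k (x t)) / h -
  (k' (x t) + Derive x t * Derive_n (fun y => Re (c t y)) (S j) (x t))) < eps).
match goal with |- Rabs ?a < _ => replace a with
  ((/ h * (Re (Dn j (c (t + h)) (x (t + h))) - k (x (t + h))) - k' (x (t + h))) +
   (k' (x (t + h)) - k' (x t)) +
   ((k (x (t + h)) - k (x t)) / h - Derive x t * Derive_n (fun y => Re (c t y)) (S j) (x t))) end.
2: { field; auto. }
eapply Rle_lt_trans; [apply Rabs_triang|].
eapply Rle_lt_trans; [apply Rplus_le_compat_r, Rabs_triang|]. lra.
Qed.

(** The j-th derivatives at x t of the i-th curve derivatives of c, together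
with the derivatives of x, generate an algebra closed under d/dt. *)
Lemma evaluation_smooth c x : smooth_curve whole c -> smoothR x ->
  smoothR (fun t => Re (c t (x t))).
Proof.
intros [d [td [d0 hd]]] hx.
set (B := fun (_ : nat) f =>
  (exists i j, f = fun _ t : R => Re (Dn j (d i t) (x t))) \/
  (exists j, f = fun _ : R => Derive_n x j)).
replace (fun t => Re (c t (x t))) with (fun t => Re (Dn 0 (d 0%nat t) (x t))).
2: { apply functional_extensionality; intros t; rewrite Dn_0, d0; auto. }
apply (graded_smooth whole B 0 (fun _ t => Re (Dn 0 (d 0%nat t) (x t))) 0).
- intros n f [[i [j ->]]|[j ->]].
  + exists (fun _ t => Re (Dn j (d (S i) t) (x t)) +
      Derive_n x 1 t * Re (Dn (S j) (d i t) (x t))); split.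
    * apply (graded_plus B (S n) (fun _ t => Re (Dn j (d (S i) t) (x t)))
        (fun _ t => Derive_n x 1 t * Re (Dn (S j) (d i t) (x t)))).
      -- apply graded_base; left; eauto.
      -- apply (graded_mult B 0 (S n) (fun _ => Derive_n x 1)
           (fun _ t => Re (Dn (S j) (d i t) (x t)))); apply graded_base; [right|left]; eauto.
    * intros _ t _; apply evaluation_derive; auto.
  + exists (fun _ => Derive_n x (S j)); split; [apply graded_base; right; eauto|].
    intros _ t _; apply smoothR_is_derive, hx.
- apply graded_base; left; eauto.
- exact I.
Qed.

(** * Test functions with vanishing moments and nonzero value at the origin *)

Lemma integral_support f m M : m <= M ->
  (forall x, continuous (fun x => Re (f x)) x) -> (forall x, continuous (fun x => Im (f x)) x) ->
  (forall x, ~ (m <= x <= M) -> f x = RtoC 0) ->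
  integral f (RInt (fun x => Re (f x)) m M, RInt (fun x => Im (f x)) m M).
Proof.
intros hm cr ci of P hP.
exists (fun a => a < m) (fun b => M < b); [exists m; auto|exists M; auto|].
intros a b ha hb; eexists; split; [|apply (locally_singleton _ _ hP)]; simpl.
assert (main : is_RInt (V := C_R_NormedModule) f m M
  (RInt (fun x => Re (f x)) m M, RInt (fun x => Im (f x)) m M)).
{ apply (is_RInt_fct_extend_pair (U := R_NormedModule) (V := R_NormedModule) f);
    apply (RInt_correct (V := R_CompleteNormedModule)); apply (ex_RInt_continuous (V := R_CompleteNormedModule)); intros z _;
    [apply cr|apply ci]. }
assert (z : forall c d, c <= d -> d <= m \/ M <= c -> is_RInt (V := C_R_NormedModule) f c d zero).
{ intros c d hcd hout.
  apply (is_RInt_ext (V := C_R_NormedModule) (fun _ => zero)).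
  - intros x hx; rewrite Rmin_left, Rmax_right in hx by auto.
    symmetry; apply of; lra.
  - refine (eq_rect _ (is_RInt (V := C_R_NormedModule) (fun _ => zero) c d)
      (is_RInt_const c d zero) _ _).
    exact (scal_zero_r (V := C_R_ModuleSpace) (d - c)). }
match goal with |- is_RInt _ _ _ ?v =>
  rewrite <- (plus_zero_l (G := C_R_NormedModule) v), <- (plus_zero_r (G := C_R_NormedModule) v) end.
apply (is_RInt_Chasles (V := C_R_NormedModule) f a m b); [apply z; lra|].
apply (is_RInt_Chasles (V := C_R_NormedModule) f m M b); [exact main|apply z; lra].
Qed.

Lemma integral_plus f g u v :
  integral f u -> integral g v -> integral (fun x => (f x + g x)%C) (u + v)%C.
Proof.
exact (@is_RInt_gen_plus C_R_NormedModule (Rbar_locally m_infty) (Rbar_locally p_infty)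
  _ _ f g u v).
Qed.

Lemma moment_exists k f : test whole f -> exists v, integral (fun x => (RtoC (x ^ k) * f x)%C) v.
Proof.
intros tf; destruct (test_whole_elim f tf) as [sf [m [M of]]].
assert (cp : forall x, continuous (fun x => x ^ k) x).
{ intros x; apply (ex_derive_continuous (fun x => x ^ k)), (ex_derive_n_pow 1 k x). }
assert (hM : m <= Rmax m M) by apply Rmax_l.
eexists; apply integral_support with (m := m) (M := Rmax m M); auto.
- intros x; apply continuous_ext with (fun x => x ^ k * Re (f x)).
  { intros t; change (t ^ k * Re (f t) = t ^ k * Re (f t) - 0 * Im (f t)); ring. }
  apply (continuous_mult (fun x => x ^ k)); auto.
  apply (ex_derive_continuous (fun x => Re (f x))), (smooth_Re f sf 1%nat).
- intros x; apply continuous_ext with (fun x => x ^ k * Im (f x)).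
  { intros t; change (t ^ k * Im (f t) = t ^ k * Im (f t) + 0 * Re (f t)); ring. }
  apply (continuous_mult (fun x => x ^ k)); auto.
  apply (ex_derive_continuous (fun x => Im (f x))), (smooth_Im f sf 1%nat).
- intros x hx; rewrite of; [apply Cmult_0_r|].
  intros [h1 h2]; apply hx; split; auto; eapply Rle_trans; [apply h2|apply Rmax_r].
Qed.

Lemma moment_Sc k eps f v : 0 < eps -> integral (fun x => (RtoC (x ^ k) * f x)%C) v ->
  integral (fun x => (RtoC (x ^ k) * Sc eps f x)%C) (RtoC (eps ^ k) * v)%C.
Proof.
intros he hv.
apply integral_ext with (fun x => (RtoC (eps ^ k) * (RtoC (/ eps) *
  (RtoC ((/ eps * x + 0) ^ k) * f (/ eps * x + 0)%R)))%C).
- intros x; rewrite Sc_lin.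
  replace (x ^ k) with (eps ^ k * (/ eps * x + 0) ^ k).
  + rewrite RtoC_mult; apply Cmult_swap.
  + rewrite <- Rpow_mult_distr; f_equal; field; lra.
- apply integral_scal.
  apply (integral_comp_lin (fun x => (RtoC (x ^ k) * f x)%C)); auto.
  apply Rinv_0_lt_compat, he.
Qed.

Definition affine_comb (a : R) (f g : R -> C) (x : R) : C :=
  (RtoC a * f x + RtoC (1 - a) * g x)%C.

Lemma moment_affine_comb k a f g u v :
  integral (fun x => (RtoC (x ^ k) * f x)%C) u -> integral (fun x => (RtoC (x ^ k) * g x)%C) v ->
  integral (fun x => (RtoC (x ^ k) * affine_comb a f g x)%C) (RtoC a * u + RtoC (1 - a) * v)%C.
Proof.
intros hu hv.
apply integral_ext with (fun x => (RtoC a * (RtoC (x ^ k) * f x) +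
  RtoC (1 - a) * (RtoC (x ^ k) * g x))%C); [intros x; unfold affine_comb; ring|].
apply integral_plus; apply integral_scal; auto.
Qed.

Lemma A_affine_comb q a f g : A q whole f -> A q whole g -> A q whole (affine_comb a f g).
Proof.
intros [tf [i0f mf]] [tg [i0g mg]]; split; [|split].
- apply (test_plus (fun x => (RtoC a * f x)%C)); apply test_scal; auto.
- replace (RtoC 1) with (RtoC a * RtoC 1 + RtoC (1 - a) * RtoC 1)%C.
  + apply integral_plus; apply integral_scal; auto.
  + rewrite <- !RtoC_mult, <- RtoC_plus; f_equal; ring.
- intros k hk; replace (RtoC 0) with (RtoC a * RtoC 0 + RtoC (1 - a) * RtoC 0)%C by ring.
  apply moment_affine_comb; auto.
Qed.

Lemma affine_comb_Sc_0 a f : Re (affine_comb a f (Sc 2 f) 0) = (1 + a) / 2 * Re (f 0).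
Proof.
unfold affine_comb, Sc; replace (0 / 2) with 0 by field.
unfold Re, Cplus, Cmult, RtoC; cbn [fst snd]; field.
Qed.

(** By induction on q: a f + (1 - a) Sc 2 f keeps the integral and the vanishing
moments for all a, and the right a cancels the next moment.  This a exceeds 1,
so the factor (1 + a) / 2 picked up by the value at 0 is not 0. *)
Lemma A_nonzero_at_0 q : exists f, A q whole f /\ Re (f 0) <> 0.
Proof.
induction q as [|q [f [hf f0]]].
- set (v := RInt bump (-1) 1).
  assert (cb : forall x, continuous bump x).
  { intros x; apply (ex_derive_continuous bump), (bump_smooth 1%nat). }
  assert (hv : 0 < v).
  { apply RInt_gt_0; [lra|apply bump_pos|auto]. }
  assert (sb := smooth_RtoC bump bump_smooth).
  assert (ob : forall x, ~ (-1 <= x <= 1) -> RtoC (bump x) = RtoC 0).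
  { intros x hx; f_equal; apply bump_out; lra. }
  exists (fun x => (RtoC (/ v) * RtoC (bump x))%C); split; [split; [|split]|].
  + apply test_scal; apply test_whole_intro with (-1) 1; auto.
  + replace (RtoC 1) with (RtoC (/ v) * RtoC v)%C
      by (rewrite <- RtoC_mult; f_equal; field; lra).
    apply integral_scal.
    replace (RtoC v) with (RInt (fun x => Re (RtoC (bump x))) (-1) 1,
      RInt (fun x => Im (RtoC (bump x))) (-1) 1).
    * apply (integral_support (fun x => RtoC (bump x))); auto; [lra|].
      intros x; apply (continuous_const (U := R_UniformSpace)).
    * unfold RtoC; f_equal. apply (is_RInt_unique (V := R_CompleteNormedModule)).
      replace 0 with (scal (V := R_NormedModule) (1 - -1) 0) at 1
        by apply (scal_zero_r (V := R_NormedModule)).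
      apply (is_RInt_const (V := R_NormedModule)).
  + intros k hk; lia.
  + rewrite <- RtoC_mult; simpl.
    assert (0 < bump 0) by (apply bump_pos; lra).
    apply Rmult_integral_contrapositive; split; [apply Rinv_neq_0_compat|]; lra.
- assert (h2 : 2 <= 2 ^ S q).
  { simpl. assert (1 <= 2 ^ q) by (apply pow_R1_Rle; lra); lra. }
  (* The solution of a + (1 - a) 2 ^ (q + 1) = 0: the scaling multiplies the
     moment of order q + 1 by 2 ^ (q + 1). *)
  set (a := 2 ^ S q / (2 ^ S q - 1)).
  exists (affine_comb a f (Sc 2 f)); split.
  + assert (hg : A q whole (Sc 2 f)) by (apply A_Sc; [lra|auto]).
    destruct (A_affine_comb q a f (Sc 2 f) hf hg) as [t [i m]].
    split; [exact t|split; [exact i|]]; intros k hk.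
    destruct (Nat.eq_dec k (S q)) as [->|hne]; [|apply m; lia].
    destruct (moment_exists (S q) f (proj1 hf)) as [v hv].
    replace (RtoC 0) with (RtoC a * v + RtoC (1 - a) * (RtoC (2 ^ S q) * v))%C.
    * apply moment_affine_comb; auto; apply moment_Sc; auto; lra.
    * replace (RtoC a * v + RtoC (1 - a) * (RtoC (2 ^ S q) * v))%C
        with ((RtoC a + RtoC (1 - a) * RtoC (2 ^ S q)) * v)%C by ring.
      rewrite <- RtoC_mult, <- RtoC_plus.
      replace (a + (1 - a) * 2 ^ S q) with 0 by (unfold a; field; lra).
      apply Cmult_0_l.
  + rewrite affine_comb_Sc_0.
    assert (0 < a) by (apply Rdiv_lt_0_compat; lra).
    apply Rmult_integral_contrapositive; split; lra.
Qed.

(** The expression inside p is (difference quotient of e - e' t) g. *)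
Lemma affine_curve_derivative (f g : R -> C) (e : R -> R) (t : R) :
  test whole g -> ex_derive e t -> forall p, LF_seminorm whole p ->
  is_lim (fun h => p (fun x => (RtoC (/ h) * ((f x + RtoC (e (t + h)%R) * g x) -
    (f x + RtoC (e t) * g x)) - (RtoC 0 + RtoC (Derive e t) * g x))%C)) 0 0.
Proof.
intros tg he p hp.
assert (hl : is_derive e t (Derive e t)) by (apply Derive_correct, he).
apply is_derive_Reals in hl; apply is_lim_spec; intros eps.
pose proof (LF_seminorm_ge0 whole p g hp tg) as hg.
assert (hd : 0 < eps / (p g + 1)) by (apply Rdiv_lt_0_compat; [apply eps|lra]).
destruct (hl _ hd) as [d H]; exists d; intros h hh h0.
assert (hh' : Rabs h < d) by (replace h with (h - 0) by ring; apply hh).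
specialize (H h h0 hh').
set (z := (e (t + h) - e t) / h - Derive e t) in H.
rewrite Rminus_0_r.
replace (fun x => (RtoC (/ h) * ((f x + RtoC (e (t + h)%R) * g x) -
    (f x + RtoC (e t) * g x)) - (RtoC 0 + RtoC (Derive e t) * g x))%C)
  with (fun x => (RtoC z * g x)%C).
- rewrite (proj1 (proj2 hp)) by auto.
  rewrite Cmod_R, Rabs_mult, Rabs_Rabsolu, (Rabs_right (p g)) by lra.
  apply Rle_lt_trans with (eps / (p g + 1) * p g).
  + apply Rmult_le_compat_r; lra.
  + apply Rlt_le_trans with (eps / (p g + 1) * (p g + 1)).
    * apply Rmult_lt_compat_l; lra.
    * right; field; lra.
- apply functional_extensionality; intros x; unfold z.
  unfold Rdiv, Rminus; rewrite RtoC_plus, RtoC_opp, RtoC_mult, RtoC_plus, RtoC_opp; ring.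
Qed.

Lemma affine_smooth_curve f g (e : R -> R) : test whole f -> test whole g -> smoothR e ->
  smooth_curve whole (fun t x => (f x + RtoC (e t) * g x)%C).
Proof.
intros tf tg he.
(* Only the zeroth derivative contains the constant term f. *)
exists (fun n t x => ((match n with O => f x | _ => RtoC 0 end) + RtoC (Derive_n e n t) * g x)%C).
split; [|split].
- intros n t; apply (test_plus (fun x => match n with O => f x | _ => RtoC 0 end));
    [destruct n; [auto|apply test_0]|apply test_scal, tg].
- reflexivity.
- intros n t p hp.
  apply (affine_curve_derivative (fun x => match n with O => f x | _ => RtoC 0 end) g
    (Derive_n e n) t); auto; apply (he (S n)).
Qed.

Lemma affine_Cb q f g : test whole f -> test whole g ->
  (forall eps, A q whole (fun x => (f x + RtoC eps * g x)%C)) ->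
  Cb q whole (fun eps _ x => (f x + RtoC eps * g x)%C).
Proof.
intros tf tg hA; split; [auto|split].
- intros e x [_ he] _; apply affine_smooth_curve; auto.
- intros K a _.
  assert (e : forall eps x, (fun xi => Dn a (fun _ => (f xi + RtoC eps * g xi)%C) x) =
    fun xi => match a with O => (f xi + RtoC eps * g xi)%C | _ => RtoC 0 end).
  { intros eps x; apply functional_extensionality; intros xi; apply Dn_cst. }
  split.
  + intros h [eps [x [_ [_ ->]]]]; rewrite e; destruct a; [apply hA|apply test_0].
  + intros p hp; exists (p f + p g); intros h [eps [x [he [_ ->]]]]; rewrite e.
    pose proof (LF_seminorm_ge0 whole p f hp tf); pose proof (LF_seminorm_ge0 whole p g hp tg).
    destruct a; [|rewrite (LF_seminorm_0 whole p hp); lra].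
    eapply Rle_trans; [apply (proj1 hp); [auto|apply test_scal, tg]|].
    rewrite (proj1 (proj2 hp)), Cmod_R by auto.
    unfold I01 in he; rewrite Rabs_right by lra; nra.
Qed.

(** The path runs along the affine line through phi and Sc 2 phi, where phi in
A_q has Re (phi 0) = r <> 0.  At the point a phi + (1 - a) Sc 2 phi the value at
0 is (1 + a) r / 2, which equals eps for a = -1 + 2 eps / r. *)
Lemma affine_path q : exists f g,
  Re (f 0) = 0 /\ Re (g 0) = 1 /\ Cb q whole (fun eps _ x => (f x + RtoC eps * g x)%C).
Proof.
destruct (A_nonzero_at_0 q) as [f [hf f0]]; set (r := Re (f 0)) in *.
assert (hS : A q whole (Sc 2 f)) by (apply A_Sc; [lra|auto]).
exists (affine_comb (-1) f (Sc 2 f)),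
  (fun x => (RtoC (2 / r) * (f x + RtoC (-1) * Sc 2 f x))%C).
split; [|split].
- rewrite affine_comb_Sc_0; field.
- unfold Sc; replace (0 / 2) with 0 by field.
  transitivity (2 / r * (r + -1 * / 2 * r)); [|field; auto].
  unfold r, Re, Cplus, Cmult, RtoC; cbn [fst snd]; field; auto.
- apply affine_Cb.
  + apply (A_affine_comb q); auto.
  + apply test_scal, (test_plus f); [apply hf|apply test_scal, hS].
  + intros eps.
    replace (fun x => (affine_comb (-1) f (Sc 2 f) x + RtoC eps * (RtoC (2 / r) *
      (f x + RtoC (-1) * Sc 2 f x)))%C) with (affine_comb (-1 + eps * (2 / r)) f (Sc 2 f)).
    { apply A_affine_comb; auto. }
    apply functional_extensionality; intros x; unfold affine_comb.
    replace (1 - (-1 + eps * (2 / r))) with ((1 - -1) + -1 * (eps * (2 / r))) by ring.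
    rewrite !RtoC_plus, !RtoC_mult; ring.
Qed.

(** * The counterexample *)

Definition cutoff (r : R) : R := bump (r - 1).

Lemma cutoff_smooth : smoothR cutoff.
Proof. apply (smoothR_trans bump (- (1))), bump_smooth. Qed.

Lemma cutoff_out r : ~ (0 < r < 2) -> cutoff r = 0.
Proof. intros h; apply bump_out; lra. Qed.

Definition witness (u : Ud whole) : C := RtoC (cutoff (Re (fst (proj1_sig u) 0))).

Lemma A_inUd q f x : A q whole f -> inUd whole (f, x).
Proof.
intros [tf [i _]]; split; [|exact I].
split; [apply test_translate_whole, tf|split; [apply integral_translate, i|]].
intros k hk; lia.
Qed.

Lemma extend_witness q f x : A q whole f -> extend witness (f, x) = RtoC (cutoff (Re (f 0))).
Proof. intros hf; rewrite (extend_in _ _ (A_inUd q f x hf)); reflexivity. Qed.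

Lemma Dn_RtoC g n x : Dn n (fun x => RtoC (g x)) x = RtoC (Derive_n g n x).
Proof.
unfold Dn, RtoC; f_equal.
change (Derive_n (fun _ => 0) n x = 0); rewrite Derive_n_cst; destruct n; auto.
Qed.

Lemma witness_Ed : Ed whole witness.
Proof.
intros c x hc hA [_ hx].
apply smooth_ext with (fun t => RtoC (cutoff (Re (c t (x t))))).
- intros t; unfold Tinv; cbn [fst snd].
  assert (hT : inUd whole (fun xi => c t (xi + x t), x t)).
  { split; [|exact I]; unfold T; cbn [fst snd].
    replace (fun xi => c t (xi - x t + x t)) with (c t); [apply hA|].
    apply functional_extensionality; intros xi; f_equal; ring. }
  rewrite (extend_in _ _ hT); unfold witness; cbn [proj1_sig fst].
  rewrite Rplus_0_l; reflexivity.
- apply (smooth_RtoC (fun t => cutoff (Re (c t (x t))))),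
    (smoothR_comp cutoff (fun t => Re (c t (x t)))); [apply cutoff_smooth|].
  apply evaluation_smooth; auto.
Qed.

Lemma Sc_0 eps f : Re (Sc eps f 0) = / eps * Re (f 0).
Proof.
unfold Sc, Rdiv; rewrite Rmult_0_l; unfold Re, Cmult, RtoC; cbn [fst snd]; ring.
Qed.

(** The curve t |-> phi eps t is smooth in D(R) because t |-> (eps, t) is smooth. *)
Lemma Cb_evaluation_smooth q phi eps : Cb q whole phi -> I01 eps ->
  smoothR (fun y => Re (phi eps y 0)).
Proof.
intros [_ [hs _]] he.
apply (evaluation_smooth (phi eps) (fun _ => 0)); [|intros n x; apply ex_derive_n_const].
apply (hs (fun _ => eps) (fun y => y)).
- split; [auto|intros n t; apply ex_derive_n_const].
- split; [intros; exact I|intros n t].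
  apply ex_derive_n_ext with (fun t => t ^ 1); [intros; ring|apply ex_derive_n_pow].
Qed.

Lemma Cb_evaluation_bound q phi K a : Cb q whole phi -> ccsub K whole ->
  exists M, forall eps y, I01 eps -> K y ->
    Rabs (Derive_n (fun y => Re (phi eps y 0)) a y) <= M.
Proof.
intros [_ [_ hb]] hK; destruct (hb K a hK) as [ht hM].
destruct (hM _ (sup_norm_LF 0)) as [M h]; exists M; intros eps y he hy.
eapply Rle_trans; [|apply h; exists eps, y; split; [apply he|split; [apply hy|reflexivity]]].
eapply Rle_trans; [|apply (sup_norm_spec 0) with (x := 0), ht; eauto].
rewrite Dn_0.
apply (re_le_Cmod (Dn a (fun y => phi eps y 0) y)).
Qed.

(** The a-th derivative has degree a in 1 / eps; the exponent a + 1 is taken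
because N has to be positive. *)
Lemma witness_EMd : EMd whole witness.
Proof.
split; [apply witness_Ed|]; intros K a hK; exists (S a); split; [lia|]; intros phi hphi.
set (u := fun eps y => / eps * Re (phi eps y 0)).
assert (hu : forall eps, I01 eps -> smoothR (u eps)).
{ intros eps he; apply smoothR_scal, (Cb_evaluation_smooth 0); auto. }
assert (hB := comp_base_derive I01 cutoff u cutoff_smooth hu).
destruct (graded_Derive_n I01 (comp_base cutoff u) a 0 (fun eps y => cutoff (u eps y)) hB)
  as [g [hg eg]]; [apply graded_base, (comp_base_outer cutoff u 0)|].
destruct (graded_bound (comp_base cutoff u) K (a + 0) g) as [c hc]; auto.
{ intros n f [k|k].
  - destruct (smooth_derivatives_bounded cutoff 0 2 k cutoff_smooth) as [c hc].
    { intros x hx; apply cutoff_out; lra. }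
    exists c; intros eps y _ _; rewrite pow_O, Rinv_1, Rmult_1_r; apply hc; auto.
  - destruct (Cb_evaluation_bound 0 phi K (S k) hphi hK) as [c hc].
    exists c; intros eps y he hy; unfold u; rewrite Derive_n_scal_l, Rabs_mult, pow_1.
    assert (0 < / eps) by (apply Rinv_0_lt_compat, he).
    rewrite (Rabs_right (/ eps)), Rmult_comm by lra.
    apply Rmult_le_compat_r; [lra|auto]. }
exists c, 1; split; [lra|]; intros eps y he _ hy.
replace (fun y => extend witness (Sc eps (phi eps y), y)) with (fun y => RtoC (cutoff (u eps y))).
2: { apply functional_extensionality; intros z; unfold u; rewrite <- Sc_0; symmetry.
  apply (extend_witness 0), A_Sc; [apply he|apply hphi; [auto|exact I]]. }
rewrite Dn_RtoC, Cmod_R, eg by auto.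
eapply Rle_trans; [apply hc; auto|]; rewrite Nat.add_0_r.
assert (0 <= c * / eps ^ a).
{ eapply Rle_trans; [apply Rabs_pos|]; rewrite <- (Nat.add_0_r a) at 1; apply hc; eauto. }
assert (1 <= / eps) by (rewrite <- Rinv_1; apply Rinv_le_contravar; apply he).
simpl; rewrite Rinv_mult; nra.
Qed.

Lemma witness_not_Nd : ~ Nd whole witness.
Proof.
intros h.
assert (hK : ccsub (fun x => 0 <= x <= 0) whole).
{ split; [apply compact_P3|intros x _; exact I]. }
destruct (h _ 0%nat 1%nat hK (le_n 1)) as [q [_ hq]].
destruct (affine_path q) as [f [g [f0 [g0 hC]]]].
destruct (hq _ hC) as [M [e0 [he0 hM]]].
assert (hb : 0 < cutoff 1) by (apply bump_pos; lra).
assert (h1 : forall eps, I01 eps -> eps < e0 -> cutoff 1 <= M * eps).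
{ intros eps he hlt; specialize (hM eps 0 he hlt (conj (Rle_refl 0) (Rle_refl 0))).
  rewrite Dn_0, (extend_witness q), Sc_0, pow_1, Cmod_R in hM
    by (apply A_Sc; [apply he|exact (proj1 hC eps 0 he I)]).
  replace (/ eps * Re (f 0 + RtoC eps * g 0)%C) with 1 in hM.
  - eapply Rle_trans; [apply Rle_abs|apply hM].
  - transitivity (/ eps * (Re (f 0) + eps * Re (g 0))).
    + rewrite f0, g0; unfold I01 in he; field; lra.
    + unfold Re, Cplus, Cmult, RtoC; cbn [fst snd]; ring. }
assert (hd : 0 < cutoff 1 / (2 * (Rabs M + 1))).
{ apply Rdiv_lt_0_compat; auto; pose proof (Rabs_pos M); lra. }
(* An admissible eps with M eps < cutoff 1; M may be negative. *)
set (eps := Rmin (Rmin 1 (e0 / 2)) (cutoff 1 / (2 * (Rabs M + 1)))).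
assert (he : 0 < eps) by (repeat apply Rmin_pos; lra).
assert (e1 : eps <= Rmin 1 (e0 / 2)) by apply Rmin_l.
assert (e2 := Rmin_l 1 (e0 / 2)); assert (e3 := Rmin_r 1 (e0 / 2)).
assert (e4 : eps <= cutoff 1 / (2 * (Rabs M + 1))) by apply Rmin_r.
assert (hc : cutoff 1 <= M * eps) by (apply h1; [split|]; lra).
pose proof (Rle_abs M); pose proof (Rabs_pos M).
apply Rmult_le_compat_l with (r := Rabs M + 1) in e4; [|lra].
replace ((Rabs M + 1) * (cutoff 1 / (2 * (Rabs M + 1)))) with (cutoff 1 / 2) in e4 by (field; lra).
nra.
Qed.

(** If Re (f 0) is not 0, then |Re (f 0)| / eps > 2 for eps < |Re (f 0)| / 2. *)
Lemma witness_Ne : Ne whole (restrict witness).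
Proof.
split; [apply restrict_Ee, witness_Ed|]; intros K a n _ _; exists 1%nat; split; auto.
intros f hf.
assert (ev : exists e0, 0 < e0 /\ forall eps, 0 < eps < e0 -> cutoff (/ eps * Re (f 0)) = 0).
{ destruct (Req_dec (Re (f 0)) 0) as [h|h].
  - exists 1; split; [lra|]; intros eps _; rewrite h, Rmult_0_r; apply cutoff_out; lra.
  - pose proof (Rabs_pos_lt _ h) as hp.
    exists (Rabs (Re (f 0)) / 2); split; [lra|]; intros eps he; apply cutoff_out; intros hr.
    assert (hr' : Rabs (/ eps * Re (f 0)) < 2) by (rewrite Rabs_right; lra).
    rewrite Rabs_mult, Rabs_right in hr' by (left; apply Rinv_0_lt_compat; lra).
    apply Rmult_lt_compat_l with (r := eps) in hr'; [|lra].
    rewrite <- Rmult_assoc, Rinv_r, Rmult_1_l in hr'; lra. }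
destruct ev as [e0 [he0 h0]].
exists 0, e0; split; auto; intros eps x he hlt _.
rewrite (restrict_Sc witness 1); [|auto|apply he|auto].
replace (fun y => extend witness (Sc eps f, y)) with (fun _ : R => RtoC 0).
- rewrite Dn_cst, Rmult_0_l; destruct a; rewrite Cmod_0; lra.
- apply functional_extensionality; intros y.
  rewrite (extend_witness 1) by (apply A_Sc; [apply he|auto]).
  rewrite Sc_0, h0; [reflexivity|split; [apply he|auto]].
Qed.

(** The representative F belongs to its own coset, hence to the zero ideal. *)
Lemma class_d_eq_zero F (hF : EMd whole F) : class_d F hF = zero_d whole -> Nd whole F.
Proof.
intros h; apply (f_equal (@proj1_sig _ _)) in h; cbn in h.
assert (hin : coset (Jd whole) F F).
{ unfold coset; replace (fun u => (F u - F u)%C) with (fun _ : Ud whole => RtoC 0).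
  - split; [apply Nd_0|apply EMd_0].
  - apply functional_extensionality; intros u; symmetry; apply Cplus_opp_r. }
rewrite h in hin; destruct hin as [hN _].
replace F with (fun u => (F u - RtoC 0)%C); [exact hN|].
apply functional_extensionality; intros u; ring.
Qed.

Lemma class_e_zero F (hF : EMe whole F) : Ne whole F -> class_e F hF = zero_e whole.
Proof.
intros hN; apply eq_sig_hprop; [intros; apply proof_irrelevance|]; cbn.
apply functional_extensionality; intros G; apply PropExtensionality.propositional_extensionality.
unfold coset; split; intros hG.
- replace (fun u => (G u - RtoC 0)%C) with (fun u => ((G u - F u) + F u)%C)
    by (apply functional_extensionality; intros u; ring).
  apply Ne_plus; auto.
- replace (fun u => (G u - F u)%C) with (fun u => ((G u - RtoC 0) + - F u)%C)
    by (apply functional_extensionality; intros u; ring).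
  apply Ne_plus; auto; apply Ne_opp, hN.
Qed.

Lemma Phi_zero : Phi (zero_d whole) = zero_e whole.
Proof.
unfold zero_d; rewrite Phi_class; apply class_e_zero.
apply restrict_Ne; [apply EMd_0|apply Nd_0].
Qed.

Theorem mainTheorem2 :
  (exists (F : Ud whole -> C) (hF : EMd whole F),
     Ed whole F /\ EMd whole F /\ ~ Nd whole F /\ Ne whole (restrict F) /\
     class_d F hF <> zero_d whole /\
     Phi (class_d F hF) = zero_e whole) /\
  ~ (forall X Y : Gd whole, Phi X = Phi Y -> X = Y).
Proof.
assert (nonzero : class_d witness witness_EMd <> zero_d whole).
{ intros h; apply witness_not_Nd, (class_d_eq_zero _ _ h). }
assert (killed : Phi (class_d witness witness_EMd) = zero_e whole).
{ rewrite Phi_class; apply class_e_zero, witness_Ne. }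
split.
- exists witness, witness_EMd.
  exact (conj witness_Ed (conj witness_EMd (conj witness_not_Nd
    (conj witness_Ne (conj nonzero killed))))).
- intros inj; apply nonzero, inj; rewrite killed, Phi_zero; reflexivity.
Qed.
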